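(* Let $\mathcal S$ be the category of compactly generated topological spaces or the category of $I$-generated topological spaces. Let $D$ be a small category such that the category $\mathcal O_D$ of $D$-orbits contains a proper class of (pairwise non-isomorphic) regular orbits. Then there does not exist a set $S$ of maps of $D$-diagrams in $\mathcal S$ such that $L_S(X)\simeq *$ for every $D$-diagram $X\in\mathcal S^D$.
   Context: $\mathcal S$ carries its standard simplicial model structure. $I$-generated spaces (also called $\Delta$-generated spaces) are the topological spaces whose topology is final with respect to all continuous maps from the interval $[0,1]$ (equivalently, from standard topological simplices). For a small category $D$, $\mathcal S^D$ is the category of $D$-shaped diagrams (functors $D\to\mathcal S$). For a simplicial set $L$ and a diagram $X$, $L\otimes X$ is the diagram $d\mapsto |L|\times X(d)$, and $\hom(X,Y)$ is the simplicial function complex, with $n$-simplices the maps $\Delta^n\otimes X\to Y$. The constant diagram of points is denoted $*$. Orbits: a diagram $T\in\mathcal S^D$ is an orbit if $\mathrm{colim}_D\,T=*$; $\mathcal O_D$ is the full subcategory of orbits. An orbit $T$ is regular if there exists a map of diagrams $*\to T$, equivalently $\lim_D T\neq\emptyset$. Equivariant model structure on $\mathcal S^D$: a map $f\colon X\to Y$ is a weak equivalence (respectively fibration) if for every orbit $T$ the induced map $\hom(T,f)\colon\hom(T,X)\to\hom(T,Y)$ is a weak equivalence (respectively fibration) of simplicial sets; cofibrations are the maps with the left lifting property with respect to maps that are both fibrations and weak equivalences. This is a simplicial model category, in which every object is fibrant. Here $X\simeq *$ means that $X\to *$ is a weak equivalence in this model structure. Localization: for a set $S$ of maps of diagrams,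 a fibrant diagram $Z$ is $S$-local if for every $f\in S$ and a cofibrant approximation $\tilde f$ of $f$ (a map between cofibrant diagrams weakly equivalent to $f$) the map $\hom(\tilde f,Z)$ is a weak equivalence of simplicial sets. A map $g$ is an $S$-local equivalence if for a cofibrant approximation $\tilde g$ of $g$, $\hom(\tilde g,Z)$ is a weak equivalence for every $S$-local $Z$. $L_S$ denotes the $S$-localization functor: a coaugmented functor $\mathcal S^D\to\mathcal S^D$ such that for every $X$ the diagram $L_S(X)$ is $S$-local and the coaugmentation $X\to L_S(X)$ is an $S$-local equivalence. *)

(* Defs.v *)
From HB Require Import structures.
From mathcomp Require Import all_boot all_order all_algebra generic_quotient.
From mathcomp Require Import boolp classical_sets functions reals topology.
From Stdlib Require Import Relation_Operators.

Set Implicit Arguments.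
Unset Strict Implicit.
Unset Printing Implicit Defensive.

Import Order.TTheory GRing.Theory Num.Theory numFieldTopology.Exports.

Local Open Scope classical_set_scope.
Local Open Scope ring_scope.
Local Open Scope quotient_scope.

(* A "set" (as opposed to a proper class) is a type in the universe of the    *)
(* carriers of topological spaces. With this choice the spaces themselves,    *)
(* and the diagrams of spaces, form proper classes.                           *)
Notation small := Type@{Topological.axioms_.u0} (only parsing).

Definition pair_map (A B C D : Type) (f : A -> B) (g : C -> D) (p : A * C) :
  B * D := (f p.1, g p.2).

Lemma pair_map_continuous (A B C D : topologicalType) (f : A -> B)
    (g : C -> D) :
  continuous f -> continuous g -> continuous (pair_map f g).
Proof.
move=> cf cg p; apply: (@cvg_pair _ _ _ _ (nbhs (f p.1)) (nbhs (g p.2))).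
  by apply: continuous_comp; [exact: cvg_fst | exact: cf].
by apply: continuous_comp; [exact: cvg_snd | exact: cg].
Qed.

Variant convenient_category := CompactlyGenerated | IGenerated.

Section Spaces.
Variables (R : realType) (S : convenient_category).

Definition unit_interval : topologicalType := set_type [set` `[0 : R, 1 : R]].

(* The spaces with respect to which the topology of an object of the category *)
(* is required to be final. No separation axiom is imposed on the objects.    *)
Definition test_space (K : topologicalType) : Prop :=
  match S with
  | CompactlyGenerated => compact [set: K] /\ hausdorff_space K
  | IGenerated => K = unit_interval
  end.

Definition test_open (X : topologicalType) (U : set X) : Prop :=
  forall (K : topologicalType) (phi : continuousType K X),
    test_space K -> open (phi @^-1` U).

Definition is_generated (X : topologicalType) : Prop :=
  forall U : set X, test_open U -> open U.

Record space := Space {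
  space_top :> topologicalType;
  spaceP : is_generated space_top
}.

(* Coreflection of topological spaces into the category: same points, final   *)
(* topology with respect to the maps from the test spaces.                    *)
Definition generate (X : topologicalType) : Type := X.

Section Generate.
Variable X : topologicalType.

HB.instance Definition _ := Choice.copy (generate X) X.

Let test_openT : test_open [set: X].
Proof. by move=> K phi _; rewrite preimage_setT; exact: openT. Qed.

Let test_openI : setI_closed (@test_open X).
Proof.
move=> A B oA oB K phi tK; rewrite preimage_setI.
by apply: openI; [exact: oA | exact: oB].
Qed.

Let test_open_bigU (I : Type) (f : I -> set X) :
  (forall i, test_open (f i)) -> test_open (\bigcup_i f i).
Proof.
move=> of_ K phi tK; rewrite preimage_bigcup.
by apply: bigcup_open => i _; exact: of_.
Qed.

HB.instance Definition _ := @isOpenTopological.Build (generate X)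
  (@test_open X) test_openT test_openI test_open_bigU.

Lemma generate_openE (U : set (generate X)) :
  open U = test_open (U : set X).
Proof. by []. Qed.

End Generate.

Lemma generate_continuous (X Y : topologicalType) (f : X -> Y) :
  continuous f -> continuous (f : generate X -> generate Y).
Proof.
move=> cf; apply/continuousP => U oU; rewrite generate_openE => K phi tK.
have cfphi : continuous (f \o phi).
  by move=> x; apply: continuous_comp; [exact: cts_fun | exact: cf].
exact: (oU K (mkcts cfphi) tK).
Qed.

Lemma generate_generated (X : topologicalType) : is_generated (generate X).
Proof.
move=> U oU; rewrite generate_openE => K phi tK.
suff cphi : continuous (phi : K -> generate X) by exact: (oU K (mkcts cphi) tK).
by apply/continuousP => V oV; exact: oV.
Qed.

Definition generate_space (X : topologicalType) : space :=
  Space (@generate_generated X).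

Lemma discrete_generated (T : choiceType) :
  is_generated (discrete_topology T).
Proof. by move=> U _; exact: discrete_open. Qed.

Definition discrete_space (T : choiceType) : space :=
  Space (@discrete_generated T).

Definition point_space : space := discrete_space unit.
Definition empty_space : space := discrete_space void.

End Spaces.

Record mono (m n : nat) := Mono {
  mono_fun :> 'I_m.+1 -> 'I_n.+1;
  mono_homo : {homo mono_fun : i j / (i <= j)%N}
}.

Lemma mono_ext m n (a b : mono m n) : a =1 b -> a = b.
Proof.
case: a b => [f fP] [g gP] /= /funext fg; subst g.
by congr Mono; exact: Prop_irrelevance.
Qed.

Definition mono_id n : mono n n := @Mono n n id (fun _ _ h => h).

Definition mono_comp l m n (b : mono m n) (a : mono l m) : mono l n :=
  @Mono l n (b \o a) (fun i j h => mono_homo b (mono_homo a h)).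

Record sset := SSet {
  simplices :> nat -> small;
  pull : forall m n, mono m n -> simplices n -> simplices m;
  pull_id : forall n (x : simplices n), pull (mono_id n) x = x;
  pull_comp : forall l m n (a : mono l m) (b : mono m n) (x : simplices n),
    pull (mono_comp b a) x = pull a (pull b x)
}.

Record smap (K L : sset) := SMap {
  smap_fun :> forall n, K n -> L n;
  smap_pull : forall m n (a : mono m n) (x : K n),
    smap_fun (pull a x) = pull a (smap_fun x)
}.

Definition std_pull n l m (a : mono l m) (x : mono m n) : mono l n :=
  mono_comp x a.

Lemma std_pull_id n m (x : mono m n) : std_pull (mono_id m) x = x.
Proof. exact: mono_ext. Qed.

Lemma std_pull_comp n l m k (a : mono l m) (b : mono m k) (x : mono k n) :
  std_pull (mono_comp b a) x = std_pull a (std_pull b x).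
Proof. exact: mono_ext. Qed.

Definition std_simplex (n : nat) : sset :=
  @SSet (fun m => mono m n) (@std_pull n) (@std_pull_id n) (@std_pull_comp n).

Definition std_map m n (b : mono m n) : smap (std_simplex m) (std_simplex n) :=
  @SMap (std_simplex m) (std_simplex n) (fun l x => mono_comp b x)
    (fun k l a x => @mono_ext k n (mono_comp b (mono_comp x a))
      (mono_comp (mono_comp b x) a) (fun=> erefl)).

(* The horn Lambda^n_k consists of the simplices of Delta^n lying on one of   *)
(* the faces opposite to a vertex j != k.                                     *)
Definition in_horn n (k : 'I_n.+1) m (x : mono m n) : Prop :=
  exists2 j : 'I_n.+1, j != k & forall i, x i != j.

Lemma in_horn_pull n (k : 'I_n.+1) l m (a : mono l m) (x : mono m n) :
  in_horn k x -> in_horn k (std_pull a x).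
Proof. by case=> j jk xj; exists j => // i; exact: xj. Qed.

Definition horn_pull n (k : 'I_n.+1) l m (a : mono l m)
    (x : {x : mono m n | in_horn k x}) : {x : mono l n | in_horn k x} :=
  exist _ (std_pull a (sval x)) (in_horn_pull a (svalP x)).

Lemma horn_pull_id n (k : 'I_n.+1) m (x : {x : mono m n | in_horn k x}) :
  horn_pull (mono_id m) x = x.
Proof. by case: x => x xP; apply: eq_exist; exact: std_pull_id. Qed.

Lemma horn_pull_comp n (k : 'I_n.+1) l m p (a : mono l m) (b : mono m p)
    (x : {x : mono p n | in_horn k x}) :
  horn_pull (mono_comp b a) x = horn_pull a (horn_pull b x).
Proof. by apply: eq_exist; exact: std_pull_comp. Qed.

Definition horn n (k : 'I_n.+1) : sset :=
  SSet (@horn_pull_id n k) (@horn_pull_comp n k).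

Definition horn_incl n (k : 'I_n.+1) : smap (horn k) (std_simplex n) :=
  @SMap (horn k) (std_simplex n) (fun m x => sval x) (fun _ _ _ _ => erefl).

Definition kan_fibration (K L : sset) (p : smap K L) : Prop :=
  forall n (k : 'I_n.+2) (u : smap (horn k) K) (v : smap (std_simplex n.+1) L),
    (forall m (x : horn k m), p m (u m x) = v m (horn_incl k m x)) ->
    exists w : smap (std_simplex n.+1) K,
      (forall m (x : horn k m), w m (horn_incl k m x) = u m x) /\
      (forall m (x : std_simplex n.+1 m), p m (w m x) = v m x).

Section Realization.
Variable R : realType.

Definition in_simplex n (t : 'rV[R]_n.+1) : Prop :=
  (forall i, 0 <= t 0 i) /\ \sum_i t 0 i = 1.

Definition simplex (n : nat) : topologicalType :=
  set_type [set t : 'rV[R]_n.+1 | in_simplex t].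

Definition push_row m n (a : mono m n) (t : 'rV[R]_m.+1) : 'rV[R]_n.+1 :=
  \row_j \sum_(i | a i == j) t 0 i.

Lemma push_row_in m n (a : mono m n) (t : simplex m) :
  push_row a (val t) \in [set t : 'rV[R]_n.+1 | in_simplex t].
Proof.
case: t => t /=; rewrite !inE => -[t0 t1]; split=> [j|].
  by rewrite mxE; apply: sumr_ge0.
rewrite -t1 [RHS](partition_big a xpredT)//=.
by apply: eq_bigr => j _; rewrite mxE.
Qed.

(* The affine map of simplices that sends the vertex i to the vertex a i. *)
Definition push m n (a : mono m n) (t : simplex m) : simplex n :=
  exist _ (push_row a (val t)) (push_row_in a t).

Section RealizationSpace.
Variable K : sset.

(* The disjoint union of the K_n x |Delta^n|, with K_n discrete. *)
Definition cells : topologicalType :=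
  {n & (discrete_topology {classic K n} * simplex n)%type}.

Definition cell n (x : K n) (t : simplex n) : cells :=
  existT (fun n => (discrete_topology {classic K n} * simplex n)%type) n (x, t).

Inductive glue : cells -> cells -> Prop :=
  Glue m n (a : mono m n) (x : K n) (t : simplex m) :
    glue (cell (pull a x) t) (cell x (push a t)).

Definition glue_eq (p q : cells) : bool :=
  `[< clos_refl_sym_trans cells glue p q >].

Lemma glue_eq_refl : reflexive glue_eq.
Proof. by move=> p; apply/asboolP; exact: rst_refl. Qed.

Lemma glue_eq_sym : symmetric glue_eq.
Proof. by move=> p q; apply/asboolP/asboolP; exact: rst_sym. Qed.

Lemma glue_eq_trans : transitive glue_eq.
Proof.
by move=> q p r /asboolP pq /asboolP qr; apply/asboolP; exact: rst_trans qr.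
Qed.

Canonical glue_equiv := EquivRel glue_eq glue_eq_refl glue_eq_sym glue_eq_trans.

Definition realization : topologicalType :=
  quotient_topology {eq_quot glue_equiv}.

Definition to_realization (p : cells) : realization :=
  \pi_(quotient_topology {eq_quot glue_equiv}) p.

Lemma to_realization_repr (p : realization) : to_realization (repr p) = p.
Proof. exact: reprK. Qed.

Lemma to_realizationP (p q : cells) :
  to_realization p = to_realization q <-> glue_eq p q.
Proof. by split=> [/eqmodP|pq] //; exact/eqmodP. Qed.

Lemma to_realization_continuous : continuous to_realization.
Proof. exact: pi_continuous. Qed.

End RealizationSpace.

Section RealizationMap.
Variables (K L : sset) (f : smap K L).

Definition cells_map (p : cells K) : cells L :=
  cell (f _ (tagged p).1) (tagged p).2.

Lemma cells_map_glue (p q : cells K) :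
  glue_eq p q -> glue_eq (cells_map p) (cells_map q).
Proof.
move=> /asboolP pq; apply/asboolP; elim: pq => {p q}.
- move=> _ _ [m n a x t]; apply: rst_step.
  by rewrite /cells_map /= smap_pull; exact: Glue.
- by move=> p; exact: rst_refl.
- by move=> p q _; exact: rst_sym.
- by move=> p q r _ pq _; exact: rst_trans.
Qed.

Lemma cells_map_continuous : continuous cells_map.
Proof.
apply/continuousP => U /sigT_openP oU; apply/sigT_openP => n.
suff /continuousP ch : continuous (pair_map
    (f n : discrete_topology {classic K n} -> discrete_topology {classic L n})
    (@id (simplex n))) by exact: (ch _ (oU n)).
apply: pair_map_continuous; last by move=> t.
apply/continuousP => A _.
exact: (@discrete_open (discrete_topology {classic K n})).
Qed.

Definition realization_fun (p : realization K) : realization L :=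
  to_realization (cells_map (repr p)).

Lemma realization_fun_pi (p : cells K) :
  realization_fun (to_realization p) = to_realization (cells_map p).
Proof.
apply/to_realizationP/cells_map_glue/to_realizationP.
exact: to_realization_repr.
Qed.

Lemma realization_fun_continuous : continuous realization_fun.
Proof.
apply/quotient_continuous.
rewrite (_ : _ \o _ = @to_realization L \o cells_map).
  move=> p; apply: continuous_comp; first exact: cells_map_continuous.
  exact: to_realization_continuous.
by apply/funext => p; exact: realization_fun_pi.
Qed.

Definition realization_map : continuousType (realization K) (realization L) :=
  mkcts realization_fun_continuous.

End RealizationMap.

Lemma realization_map_id (K : sset) (f : smap K K) :
  (forall n (x : K n), f n x = x) -> forall p, realization_map f p = p.
Proof.
move=> fE p; rewrite -[p]to_realization_repr [LHS]realization_fun_pi.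
congr to_realization; by case: (repr p) => n [x t]; rewrite /cells_map /= fE.
Qed.

Lemma realization_map_comp (K L M : sset) (f : smap K L) (g : smap L M)
    (h : smap K M) :
  (forall n (x : K n), h n x = g n (f n x)) ->
  forall p, realization_map h p = realization_map g (realization_map f p).
Proof.
move=> hE p; rewrite -[p]to_realization_repr /= /mkcts !realization_fun_pi.
congr to_realization; by case: (repr p) => n [x t]; rewrite /cells_map /= hE.
Qed.

Definition cube (n : nat) : topologicalType :=
  set_type [set t : 'rV[R]_n | forall i, 0 <= t 0 i <= 1].

Definition on_boundary n (t : cube n) : Prop :=
  exists i, val t 0 i = 0 \/ val t 0 i = 1.

Section WeakHomotopyEquivalence.
Variables (X Y : topologicalType) (f : continuousType X Y).

Definition based (Z : topologicalType) n (z : Z)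
    (g : continuousType (cube n) Z) : Prop :=
  forall t, on_boundary t -> g t = z.

(* Homotopy relative to the boundary, of maps sending the boundary to z.      *)
Definition based_homotopic (Z : topologicalType) n (z : Z)
    (g0 g1 : continuousType (cube n) Z) : Prop :=
  exists H : continuousType (unit_interval R * cube n)%type Z,
    [/\ forall s t, val s = 0 -> H (s, t) = g0 t,
        forall s t, val s = 1 -> H (s, t) = g1 t &
        forall s t, on_boundary t -> H (s, t) = z].

(* Bijectivity of pi_n(X, x) -> pi_n(Y, f x) for all n >= 0 and all x. As the *)
(* 0-cube is a point without boundary, the case n = 0 is that of pi_0, except *)
(* that a separate condition is needed when X is empty.                       *)
Definition weak_homotopy_equivalence : Prop :=
  (inhabited Y -> inhabited X) /\
  forall n (x : X),
    (forall g0 g1 : continuousType (cube n) X, based x g0 -> based x g1 ->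
      based_homotopic (f x) (f \o g0) (f \o g1) -> based_homotopic x g0 g1) /\
    (forall h : continuousType (cube n) Y, based (f x) h ->
      exists2 g : continuousType (cube n) X, based x g &
        based_homotopic (f x) (f \o g) h).

End WeakHomotopyEquivalence.

Definition sset_weak_equivalence (K L : sset) (f : smap K L) : Prop :=
  weak_homotopy_equivalence (realization_map f).

End Realization.

Record category := Category {
  ob :> small;
  arrow : ob -> ob -> small;
  arrow_id : forall a, arrow a a;
  arrow_comp : forall a b c, arrow b c -> arrow a b -> arrow a c;
  arrow_compA : forall a b c d (w : arrow c d) (v : arrow b c) (u : arrow a b),
    arrow_comp w (arrow_comp v u) = arrow_comp (arrow_comp w v) u;
  arrow_comp_id : forall a b (u : arrow a b), arrow_comp u (arrow_id a) = u;
  arrow_id_comp : forall a b (u : arrow a b), arrow_comp (arrow_id b) u = u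
}.

Section Diagrams.
Variables (R : realType) (S : convenient_category) (D : category).

Local Notation space := (space R S).

Record diagram := Diagram {
  diag_ob :> D -> space;
  diag_arrow : forall a b : D, arrow a b ->
    continuousType (diag_ob a) (diag_ob b);
  diag_id : forall a (x : diag_ob a), diag_arrow (arrow_id a) x = x;
  diag_comp : forall a b c (v : arrow b c) (u : arrow a b) (x : diag_ob a),
    diag_arrow (arrow_comp v u) x = diag_arrow v (diag_arrow u x)
}.

Record dmap (X Y : diagram) := DMap {
  dmap_fun :> forall d, continuousType (X d) (Y d);
  dmap_nat : forall a b (u : arrow a b) (x : X a),
    dmap_fun b (diag_arrow X u x) = diag_arrow Y u (dmap_fun a x)
}.

Lemma dmap_ext (X Y : diagram) (f g : dmap X Y) :
  (forall d, f d =1 g d) -> f = g.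
Proof.
case: f g => [f fP] [g gP] /= fg.
have {}fg : f = g.
  apply: functional_extensionality_dep => d.
  exact: (proj2 (continuousEP (f d) (g d)) (fg d)).
by subst g; congr DMap; exact: Prop_irrelevance.
Qed.

Definition dmap_id (X : diagram) : dmap X X :=
  @DMap X X (fun d => idfun) (fun _ _ _ _ => erefl).

Lemma dmap_comp_nat (X Y Z : diagram) (g : dmap Y Z) (f : dmap X Y) a b
    (u : arrow a b) (x : X a) :
  (g b \o f b) (diag_arrow X u x) = diag_arrow Z u ((g a \o f a) x).
Proof. by rewrite /= !dmap_nat. Qed.

Definition dmap_comp (X Y Z : diagram) (g : dmap Y Z) (f : dmap X Y) :
  dmap X Z := @DMap X Z (fun d => g d \o f d) (dmap_comp_nat g f).

Definition isomorphic (X Y : diagram) : Prop :=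
  exists (f : dmap X Y) (g : dmap Y X),
    dmap_comp g f = dmap_id X /\ dmap_comp f g = dmap_id Y.

Definition const_diagram (P : space) : diagram :=
  @Diagram (fun=> P) (fun _ _ _ => idfun) (fun _ _ => erefl)
    (fun _ _ _ _ _ _ => erefl).

Definition point_diagram : diagram := const_diagram (point_space R S).
Definition empty_diagram : diagram := const_diagram (empty_space R S).

Definition to_point (X : diagram) : dmap X point_diagram :=
  @DMap X point_diagram (fun d => cst tt) (fun _ _ _ _ => erefl).

Lemma void_continuous (X : topologicalType) :
  continuous ((fun x : void => match x with end) : empty_space R S -> X).
Proof. by case. Qed.

Definition from_empty (X : diagram) : dmap empty_diagram X :=
  @DMap empty_diagram X (fun d => mkcts (@void_continuous (X d)))
    (fun a b u x => match x with end).

(* A cocone from X to P is a map from X to the constant diagram at P.         *)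
Definition is_colimit (X : diagram) (P : space)
    (iota : dmap X (const_diagram P)) : Prop :=
  forall (Y : space) (g : dmap X (const_diagram Y)),
    exists! h : continuousType P Y, forall d x, h (iota d x) = g d x.

Definition is_orbit (T : diagram) : Prop :=
  is_colimit (P := point_space R S) (to_point T).

Definition is_regular (T : diagram) : Prop := inhabited (dmap point_diagram T).

Section Tensor.
Variables (K : sset) (X : diagram).

(* The product in the category of spaces is the coreflection of the           *)
(* topological product.                                                       *)
Definition tensor_ob (d : D) : space :=
  generate_space R S (realization R K * X d)%type.

Definition tensor_arrow_fun a b (u : arrow a b) :
  tensor_ob a -> tensor_ob b := pair_map id (diag_arrow X u).

Lemma tensor_arrow_continuous a b (u : arrow a b) :
  continuous (tensor_arrow_fun u).
Proof.
apply: generate_continuous; apply: pair_map_continuous; first by move=> p.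
exact: cts_fun.
Qed.

Definition tensor_arrow a b (u : arrow a b) :
  continuousType (tensor_ob a) (tensor_ob b) :=
  mkcts (@tensor_arrow_continuous a b u).

Lemma tensor_arrow_id a (p : tensor_ob a) : tensor_arrow (arrow_id a) p = p.
Proof.
by case: p => p x; rewrite /= /mkcts /tensor_arrow_fun /pair_map /= diag_id.
Qed.

Lemma tensor_arrow_comp a b c (v : arrow b c) (u : arrow a b)
    (p : tensor_ob a) :
  tensor_arrow (arrow_comp v u) p = tensor_arrow v (tensor_arrow u p).
Proof. by rewrite /= /mkcts /tensor_arrow_fun /pair_map /= diag_comp. Qed.

Definition tensor : diagram := Diagram tensor_arrow_id tensor_arrow_comp.

End Tensor.

Section TensorMap.
Variables (K L : sset) (j : smap K L) (X Y : diagram) (f : dmap X Y).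

Definition tensor_map_fun d : tensor K X d -> tensor L Y d :=
  pair_map (realization_map R j) (f d).

Lemma tensor_map_continuous d : continuous (@tensor_map_fun d).
Proof.
by apply: generate_continuous; apply: pair_map_continuous; exact: cts_fun.
Qed.

Lemma tensor_map_nat a b (u : arrow a b) (p : tensor K X a) :
  mkcts (@tensor_map_continuous b) (diag_arrow (tensor K X) u p) =
  diag_arrow (tensor L Y) u (mkcts (@tensor_map_continuous a) p).
Proof.
by rewrite /= /mkcts /tensor_map_fun /tensor_arrow_fun /pair_map /= dmap_nat.
Qed.

Definition tensor_map : dmap (tensor K X) (tensor L Y) :=
  @DMap (tensor K X) (tensor L Y) (fun d => mkcts (@tensor_map_continuous d))
    tensor_map_nat.

End TensorMap.

Definition smap_id (K : sset) : smap K K :=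
  @SMap K K (fun _ => id) (fun _ _ _ _ => erefl).

Section Hom.
Variables X Y : diagram.

Definition hom_simplex (n : nat) := dmap (tensor (std_simplex n) X) Y.

Definition hom_pull m n (a : mono m n) (h : hom_simplex n) : hom_simplex m :=
  dmap_comp h (tensor_map (std_map a) (dmap_id X)).

Lemma hom_pull_id n (h : hom_simplex n) : hom_pull (mono_id n) h = h.
Proof.
apply: dmap_ext => d [p x] /=; congr (h d _).
rewrite /mkcts /tensor_map_fun /pair_map /=; congr pair.
apply: (@realization_map_id R (std_simplex n) (std_map (mono_id n)) _ p) => m y.
exact: mono_ext.
Qed.

Lemma hom_pull_comp l m n (a : mono l m) (b : mono m n) (h : hom_simplex n) :
  hom_pull (mono_comp b a) h = hom_pull a (hom_pull b h).
Proof.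
apply: dmap_ext => d [p x] /=; congr (h d _).
rewrite /mkcts /tensor_map_fun /pair_map /=; congr pair.
apply: (@realization_map_comp R (std_simplex l) (std_simplex m)
  (std_simplex n) (std_map a) (std_map b) (std_map (mono_comp b a)) _ p) => k y.
exact: mono_ext.
Qed.

Definition hom : sset := SSet hom_pull_id hom_pull_comp.

End Hom.

Lemma hom_post_pull (T X Y : diagram) (f : dmap X Y) m n (a : mono m n)
    (h : hom T X n) :
  dmap_comp f (pull a h) = pull a (dmap_comp f h : hom T Y n).
Proof. exact: dmap_ext. Qed.

Definition hom_post (T X Y : diagram) (f : dmap X Y) :
  smap (hom T X) (hom T Y) :=
  @SMap (hom T X) (hom T Y) (fun n h => dmap_comp f h) (@hom_post_pull T X Y f).

Lemma hom_pre_pull (A B Z : diagram) (f : dmap A B) m n (a : mono m n)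
    (h : hom B Z n) :
  dmap_comp (pull a h : hom B Z m) (tensor_map (smap_id (std_simplex m)) f) =
  pull a (dmap_comp h (tensor_map (smap_id (std_simplex n)) f) : hom A Z n).
Proof.
apply: dmap_ext => d [p x] /=; congr (h d _).
rewrite /mkcts /tensor_map_fun /pair_map /=; congr pair.
have idE k (q : realization R (std_simplex k)) :
    realization_map R (smap_id (std_simplex k)) q = q.
  exact: realization_map_id.
rewrite [RHS]idE; congr (realization_map R (std_map a) _); exact: idE.
Qed.

Definition hom_pre (A B Z : diagram) (f : dmap A B) :
  smap (hom B Z) (hom A Z) :=
  @SMap (hom B Z) (hom A Z)
    (fun n h => dmap_comp h (tensor_map (smap_id (std_simplex n)) f))
    (@hom_pre_pull A B Z f).

Definition weak_equivalence (X Y : diagram) (f : dmap X Y) : Prop :=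
  forall T, is_orbit T -> sset_weak_equivalence R (hom_post T f).

Definition fibration (X Y : diagram) (f : dmap X Y) : Prop :=
  forall T, is_orbit T -> kan_fibration (hom_post T f).

Definition cofibration (A B : diagram) (i : dmap A B) : Prop :=
  forall (X Y : diagram) (p : dmap X Y), fibration p -> weak_equivalence p ->
  forall (u : dmap A X) (v : dmap B Y), dmap_comp p u = dmap_comp v i ->
  exists w : dmap B X, dmap_comp w i = u /\ dmap_comp p w = v.

Definition fibrant (X : diagram) : Prop := fibration (to_point X).

Definition cofibrant (X : diagram) : Prop := cofibration (from_empty X).

Definition cofibrant_approximation (A B : diagram) (f : dmap A B)
    (A' B' : diagram) (f' : dmap A' B') : Prop :=
  [/\ cofibrant A', cofibrant B' &
    exists (a : dmap A' A) (b : dmap B' B),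
      [/\ weak_equivalence a, weak_equivalence b &
          dmap_comp f a = dmap_comp b f']].

Record map_set := MapSet {
  map_index : small;
  map_src : map_index -> diagram;
  map_tgt : map_index -> diagram;
  map_of : forall i, dmap (map_src i) (map_tgt i)
}.

(* In is_local and local_equivalence the weak equivalence is required for     *)
(* some cofibrant approximation; since the model structure is simplicial, it  *)
(* then holds for all of them.                                                *)
Definition is_local (F : map_set) (Z : diagram) : Prop :=
  fibrant Z /\
  forall i : map_index F, exists (A B : diagram) (f : dmap A B),
    cofibrant_approximation (map_of i) f /\
    sset_weak_equivalence R (hom_pre Z f).

Definition local_equivalence (F : map_set) (X Y : diagram) (g : dmap X Y) :
    Prop :=
  exists (A B : diagram) (f : dmap A B), cofibrant_approximation g f /\
    forall Z, is_local F Z -> sset_weak_equivalence R (hom_pre Z f).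

Record coaugmented_functor := CoaugmentedFunctor {
  fun_ob :> diagram -> diagram;
  fun_map : forall X Y, dmap X Y -> dmap (fun_ob X) (fun_ob Y);
  fun_map_id : forall X, fun_map (dmap_id X) = dmap_id (fun_ob X);
  fun_map_comp : forall X Y Z (g : dmap Y Z) (f : dmap X Y),
    fun_map (dmap_comp g f) = dmap_comp (fun_map g) (fun_map f);
  coaug : forall X, dmap X (fun_ob X);
  coaug_nat : forall X Y (f : dmap X Y),
    dmap_comp (coaug Y) f = dmap_comp (fun_map f) (coaug X)
}.

Definition is_localization (F : map_set) (L : coaugmented_functor) : Prop :=
  forall X, is_local F (L X) /\ local_equivalence F (coaug L X).

Definition proper_class (C : diagram -> Prop) : Prop :=
  ~ exists (I : small) (T : I -> diagram), forall X, C X -> exists i, X = T i.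

Definition pairwise_non_isomorphic (C : diagram -> Prop) : Prop :=
  forall X Y, C X -> C Y -> isomorphic X Y -> X = Y.

End Diagrams.

(* Main.v *)
From HB Require Import structures.
From mathcomp Require Import all_boot all_order all_algebra.
From mathcomp Require Import boolp classical_sets functions reals topology.
From mathcomp Require Import normedtype lra.
From Stdlib Require Import Relation_Operators.
Require Import Defs.

Set Implicit Arguments.
Unset Strict Implicit.
Unset Printing Implicit Defensive.

Import Order.TTheory GRing.Theory Num.Theory numFieldTopology.Exports.
Import numFieldNormedType.Exports.

Local Open Scope classical_set_scope.
Local Open Scope ring_scope.


(** If all the localizations [L X] are contractible, then every [F]-local diagram
    [Z] is contractible: let [g : A -> B] approximate [Z -> L Z]; as [Z] is local,
    the approximation [A -> Z] extends over [B] up to homotopy; on the other hand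
    [B] is equivalent to [L Z], hence contractible. So it suffices to find a local
    diagram that is not contractible.

    Fix cofibrant approximations of the maps of [F]. Their sources and targets
    have together only a set of points. A class of diagrams bounded in size has
    only a set of isomorphism classes ([proper_class_large]), so there is an orbit
    [T] in the given class that this set of points cannot cover. Let [Z] be [T]
    with a cone attached on each small subdiagram, where the cones have a common
    apex and are glued coherently along inclusions of subdiagrams.

    A map from a small diagram [A] to [Z] only meets a small part of [T], which is
    coned off in [Z]: so [hom(A, Z)] is contractible ([hom_contractible]). This
    holds for all the sources and targets above, thus [Z] is local, every
    diagram being fibrant ([every_diagram_fibrant]). But [T] itself is not coned
    off: from the orbit [T], made discrete, the inclusion in [Z] and the constant
    map to the apex lie in different components of the function complex
    ([full_apex_component]). Indeed the maps from an orbit to [Z] have a well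
    defined position in the poset of subdiagrams, and to leave the inclusion
    one would have to push the whole of [T] into a smaller subdiagram.

    To make continuity a matter of inequalities, [Z] is not built from cells: it
    takes values in posets with the topology of upward closed sets, where
    comparable maps are homotopic. These are generated by paths, so they belong
    to both categories of spaces.

    Contractibility of [hom(A, Z)] must be natural in simplices to give a
    contraction of its realization. It comes from a cone operator, which sends a
    map [h] to a map that is [h] near the base, the apex of [Z] near the
    apex of the simplex, and in between a map smaller than both: [h] with its
    subdiagrams cut down to what [h] meets over the carrier of each point. *)

(** * Continuity, and the unit interval as a test space *)
Section Continuity.
Context {R : realType}.

Lemma set_type_continuous (X Y : topologicalType) (A : set Y)
    (f : X -> set_type A) :
  continuous (fun x => val (f x)) -> continuous f.
Proof. exact: (@continuous_comp_initial (set_type A) X Y set_val). Qed.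

Lemma val_continuous (Y : topologicalType) (A : set Y) :
  continuous (fun x : set_type A => val x).
Proof. exact: (@initial_continuous (set_type A) Y set_val). Qed.

Lemma continuous_compT (X Y Z : topologicalType) (f : X -> Y) (g : Y -> Z) :
  continuous f -> continuous g -> continuous (fun x => g (f x)).
Proof. by move=> cf cg x; apply: continuous_comp; [exact: cf | exact: cg]. Qed.

Lemma continuous_pair (X Y Z : topologicalType) (f : X -> Y) (g : X -> Z) :
  continuous f -> continuous g -> continuous (fun x => (f x, g x)).
Proof. by move=> cf cg x; apply: cvg_pair; [exact: cf | exact: cg]. Qed.

Lemma mx_continuous (X T : topologicalType) m n (f : X -> 'M[T]_(m, n)) :
  (forall i j, continuous (fun x => f x i j)) -> continuous f.
Proof.
move=> cf x A [P fP PA].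
have : \forall y \near x, forall ij : 'I_m * 'I_n, P ij.1 ij.2 (f y ij.1 ij.2).
  by apply: filter_forall => -[i j]; exact: cf (fP i j).
by apply: filterS => y yP; apply: PA => i j; exact: (yP (i, j)).
Qed.

Lemma row_continuous (X : topologicalType) n (f : X -> 'rV[R]_n) :
  (forall i, continuous (fun x => f x 0 i)) -> continuous f.
Proof. by move=> cf; apply: mx_continuous => i j; rewrite ord1; exact: cf. Qed.

Section RealFunctions.
Context {X : topologicalType}.
Implicit Types f g : X -> R.

Lemma continuousD_fun f g : continuous f -> continuous g ->
  continuous (fun x => f x + g x).
Proof. by move=> cf cg x; apply: cvgD; [exact: cf | exact: cg]. Qed.

Lemma continuousB_fun f g : continuous f -> continuous g ->
  continuous (fun x => f x - g x).
Proof. by move=> cf cg x; apply: cvgB; [exact: cf | exact: cg]. Qed.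

Lemma continuousM_fun f g : continuous f -> continuous g ->
  continuous (fun x => f x * g x).
Proof. by move=> cf cg x; apply: cvgM; [exact: cf | exact: cg]. Qed.

Lemma continuousV_fun f : continuous f -> (forall x, f x != 0) ->
  continuous (fun x => (f x)^-1).
Proof. by move=> cf f0 x; apply: cvgV => //; exact: cf. Qed.

Lemma continuous_sum_fun (I : finType) (P : pred I) (f : I -> X -> R) :
  (forall i, P i -> continuous (f i)) -> continuous (fun x => \sum_(i | P i) f i x).
Proof. move=> cf; apply: continuous_big => //; exact: add_continuous. Qed.

Lemma continuous_bigmin_fun (I : finType) (P : pred I) (f : I -> X -> R) :
  (forall i, P i -> continuous (f i)) ->
  continuous (fun x => \big[Num.min/1]_(i | P i) f i x).
Proof. move=> cf; apply: continuous_big => //; exact: min_continuous. Qed.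

End RealFunctions.

Definition clamp (s : R) : R := Num.max 0 (Num.min 1 s).

Lemma clamp_ge0 s : 0 <= clamp s. Proof. by rewrite le_max lexx. Qed.
Lemma clamp_le1 s : clamp s <= 1.
Proof. by rewrite ge_max ler01 ge_min lexx. Qed.
Lemma clamp_id s : 0 <= s <= 1 -> clamp s = s.
Proof. by case/andP=> s0 s1; rewrite /clamp min_r// max_r. Qed.
Lemma clamp_le0 s : s <= 0 -> clamp s = 0.
Proof. by move=> s0; rewrite /clamp max_l// ge_min s0 orbT. Qed.
Lemma clamp_ge1 s : 1 <= s -> clamp s = 1.
Proof. by move=> s1; rewrite /clamp min_l// max_r. Qed.

Lemma clamp_continuous : continuous clamp.
Proof.
apply: max_fun_continuous; first exact: cst_continuous.
apply: min_fun_continuous; first exact: cst_continuous.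
by move=> s; exact: cvg_id.
Qed.

Lemma clamp_itv s : clamp s \in [set` `[0 : R, 1 : R]].
Proof. by apply: mem_set; rewrite /= in_itv /= clamp_ge0 clamp_le1. Qed.

Definition to_unit (s : R) : unit_interval R := exist _ (clamp s) (clamp_itv s).

Lemma to_unit_continuous : continuous to_unit.
Proof. by apply: set_type_continuous; exact: clamp_continuous. Qed.

Lemma unit_itvP (s : unit_interval R) : 0 <= val s <= 1.
Proof. by case: s => s sP; move: (set_mem sP); rewrite /= in_itv. Qed.

Lemma to_unit_val (s : unit_interval R) : to_unit (val s) = s.
Proof. by apply: val_inj; rewrite /= clamp_id// unit_itvP. Qed.

(** The interval tests both categories of spaces: so a topology that is already
    detected by paths is an object of either of them. *)
Lemma unit_interval_test (S : convenient_category) :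
  test_space R S (unit_interval R).
Proof.
case: S => //=; split; last first.
  move=> p q pq; apply: val_inj; apply: (@Rhausdorff R) => A B Ap Bq.
  have [r [Ar Br]] := pq _ _ (@val_continuous _ _ p _ Ap) (@val_continuous _ _ q _ Bq).
  by exists (val r).
(* Compactness: the interval is the image of a compact part of the line. *)
rewrite (_ : [set: _] = to_unit @` `[0, 1]); last first.
  apply/seteqP; split=> // s _; exists (val s); last exact: to_unit_val.
  by rewrite /= in_itv /= unit_itvP.
apply: continuous_compact; last exact: segment_compact.
by apply: continuous_subspaceT; exact: to_unit_continuous.
Qed.

End Continuity.

(** * Points of simplices and of realizations *)
Section Simplices.
Context {R : realType}.
Local Notation simplex := (simplex R).

Lemma simplex_ge0 n (t : simplex n) i : 0 <= val t 0 i.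
Proof. by case: t => t tP; case: (set_mem tP). Qed.

Lemma simplex_sum1 n (t : simplex n) : \sum_i val t 0 i = 1.
Proof. by case: t => t tP; case: (set_mem tP). Qed.

Lemma simplex_le1 n (t : simplex n) i : val t 0 i <= 1.
Proof.
rewrite -(simplex_sum1 t) (bigD1 i)//= lerDl.
by apply: sumr_ge0 => j _; exact: simplex_ge0.
Qed.

Lemma simplex_ext n (t t' : simplex n) :
  (forall i, val t 0 i = val t' 0 i) -> t = t'.
Proof. by move=> tt'; apply: val_inj; apply/rowP => i; exact: tt'. Qed.

Definition mk_simplex n (t : 'I_n.+1 -> R) (t0 : forall i, 0 <= t i)
    (t1 : \sum_i t i = 1) : simplex n.
Proof.
exists (\row_i t i); apply: mem_set; split=> [i|]; first by rewrite mxE.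
by rewrite -t1; apply: eq_bigr => i _; rewrite mxE.
Defined.

Lemma mk_simplexE n (t : 'I_n.+1 -> R) t0 t1 i :
  val (@mk_simplex n t t0 t1) 0 i = t i.
Proof. by rewrite mxE. Qed.

Lemma simplex_continuous (X : topologicalType) n (f : X -> simplex n) :
  (forall i, continuous (fun x => val (f x) 0 i)) -> continuous f.
Proof. by move=> cf; apply: set_type_continuous; exact: row_continuous. Qed.

Lemma simplex_coord_continuous n (i : 'I_n.+1) :
  continuous (fun t : simplex n => val t 0 i).
Proof.
apply: (@continuous_compT _ _ _ (fun t : simplex n => val t)
  (fun M : 'rV_n.+1 => M 0 i)).
  exact: val_continuous.
exact: coord_continuous.
Qed.

Lemma pushE m n (a : mono m n) (t : simplex m) j :
  val (push a t) 0 j = \sum_(i | a i == j) val t 0 i.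
Proof. by rewrite mxE. Qed.

Lemma push_id n (t : simplex n) : push (mono_id n) t = t.
Proof. by apply: simplex_ext => i; rewrite pushE /= big_pred1_eq. Qed.

Lemma push_comp l m n (b : mono m n) (a : mono l m) (t : simplex l) :
  push (mono_comp b a) t = push b (push a t).
Proof.
apply: simplex_ext => k; rewrite !pushE.
rewrite (partition_big a (fun j => b j == k))/=; last by move=> i; rewrite /=.
apply: eq_bigr => j /eqP bj; rewrite pushE; apply: eq_bigl => i /=.
by case: (a i =P j) => [->|]; rewrite ?bj ?eqxx ?andbF.
Qed.

Lemma push_continuous m n (a : mono m n) : continuous (push (R := R) a).
Proof.
apply: simplex_continuous => j.
rewrite (_ : (fun _ => _) = fun t : simplex m => \sum_(i | a i == j) val t 0 i).
  by apply: continuous_sum_fun => i _; exact: simplex_coord_continuous.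
by apply/funext => t; rewrite pushE.
Qed.

Lemma simplex_pos n (t : simplex n) : exists i, 0 < val t 0 i.
Proof.
apply: contrapT => /forallNP t0.
have := simplex_sum1 t; rewrite big1 => [/esym/eqP|i _]; first by rewrite oner_eq0.
by apply/eqP; rewrite eq_le simplex_ge0 andbT leNgt; apply/negP; exact: t0.
Qed.

Lemma push_pos m n (a : mono m n) (t : simplex m) i :
  0 < val t 0 i -> 0 < val (push a t) 0 (a i).
Proof.
move=> ti; rewrite pushE (bigD1 i)//=; apply: ltr_pwDl => //.
by apply: sumr_ge0 => j _; exact: simplex_ge0.
Qed.

Lemma push_posP m n (a : mono m n) (t : simplex m) j :
  0 < val (push a t) 0 j -> exists2 i, a i = j & 0 < val t 0 i.
Proof.
move=> tj; apply: contrapT => ti; move: tj; rewrite pushE big1 ?ltxx// => i /eqP ai.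
apply/eqP; rewrite eq_le simplex_ge0 andbT leNgt.
by apply/negP => ti0; apply: ti; exists i.
Qed.

End Simplices.

Section Realization.
Context {R : realType}.
Local Notation simplex := (simplex R).

Section Lift.
Variable K : sset.

(** A simplex together with a point of the standard simplex names a point of
    the realization; the gluing relation becomes [rpoint_pull]. *)
Definition rpoint n (x : K n) (t : simplex n) : realization R K :=
  to_realization (cell x t).

Lemma rpoint_pull m n (a : mono m n) (x : K n) (t : simplex m) :
  rpoint (pull a x) t = rpoint x (push a t).
Proof. by apply/to_realizationP/asboolP; apply: rst_step; exact: Glue. Qed.

Lemma rpoint_surj (p : realization R K) :
  exists n (x : K n) (t : simplex n), p = rpoint x t.
Proof.
rewrite -[p]to_realization_repr; case: (repr p) => n [x t].
by exists n, x, t.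
Qed.

Lemma cell_continuous n (x : K n) : continuous (fun t : simplex n => cell x t).
Proof.
apply: (@continuous_compT _ (discrete_topology {classic K n} * simplex n)%type _
  (fun t => (x, t)) (existT _ n)); last exact: existT_continuous.
apply: continuous_pair; first exact: cst_continuous.
by move=> t; exact: cvg_id.
Qed.

Lemma rpoint_continuous n (x : K n) : continuous (rpoint x).
Proof.
apply: continuous_compT; first exact: cell_continuous.
exact: to_realization_continuous.
Qed.

Lemma cells_continuous (Z : topologicalType) (f : cells R K -> Z) :
  (forall n (x : K n), continuous (fun t => f (cell x t))) -> continuous f.
Proof.
move=> cf [n [x t]] U fU.
rewrite /nbhs /= sigT_nbhsE.
exists ([set x : discrete_topology {classic K n}], (fun t => f (cell x t)) @^-1` U).
  by split; [exact: discrete_set1 | exact: cf fU].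
by case=> x' t' [/= -> Ut'].
Qed.

Variables (Z : Type) (f : forall n, K n -> simplex n -> Z).
Hypothesis f_pull : forall m n (a : mono m n) (x : K n) (t : simplex m),
  f (pull a x) t = f x (push a t).

Definition cells_lift (p : cells R K) : Z := f (tagged p).1 (tagged p).2.

Definition realization_lift (p : realization R K) : Z := cells_lift (repr p).

Lemma realization_liftE n (x : K n) (t : simplex n) :
  realization_lift (rpoint x t) = f x t.
Proof.
suff H p q : glue_eq p q -> cells_lift p = cells_lift q.
  by rewrite [RHS](_ : _ = cells_lift (cell x t))//;
    apply/H/to_realizationP/to_realization_repr.
move=> /asboolP; elim=> {p q}.
- by move=> _ _ [m k a y u]; exact: f_pull.
- by [].
- by move=> p q _ ->.
- by move=> p q r _ -> _ ->.
Qed.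

End Lift.

Lemma realization_lift_continuous (K : sset) (Z : topologicalType)
    (f : forall n, K n -> simplex n -> Z) :
  (forall m n (a : mono m n) (x : K n) (t : simplex m),
    f _ (pull a x) t = f _ x (push a t)) ->
  (forall n (x : K n), continuous (f n x)) ->
  continuous (realization_lift f).
Proof.
move=> f_pull cf; apply/quotient_continuous.
rewrite (_ : _ \o _ = cells_lift f); first exact: cells_continuous.
apply/funext => -[n [x t]].
exact: (@realization_liftE _ _ f f_pull n x t).
Qed.

Lemma realization_map_rpoint (K L : sset) (g : smap K L) n (x : K n)
    (t : simplex n) : realization_map R g (rpoint x t) = rpoint (g n x) t.
Proof. exact: realization_fun_pi. Qed.

Section StandardSimplex.
Variable n : nat.
Local Notation realS := (realization R (std_simplex n)).

(** The realization of the standard simplex is the topological simplex, with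
    inverse homeomorphisms [bary] and [iota_pt]; points of tensors with standard
    simplices can thus be described by barycentric coordinates. *)
Definition bary : realS -> simplex n :=
  realization_lift (fun m (x : std_simplex n m) t => push x t).

Lemma bary_pull m l (a : mono m l) (x : std_simplex n l) (t : simplex m) :
  push (pull a x) t = push x (push a t).
Proof. exact: push_comp. Qed.

Lemma bary_rpoint m (x : std_simplex n m) (t : simplex m) :
  bary (rpoint x t) = push x t.
Proof. by rewrite /bary realization_liftE//; exact: bary_pull. Qed.

Lemma bary_continuous : continuous bary.
Proof.
apply: realization_lift_continuous; first exact: bary_pull.
by move=> m x; exact: push_continuous.
Qed.

Definition iota_pt (t : simplex n) : realS :=
  rpoint (mono_id n : std_simplex n n) t.

Lemma iota_continuous : continuous iota_pt.
Proof. exact: rpoint_continuous. Qed.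

Lemma rpoint_std m (x : std_simplex n m) (t : simplex m) :
  rpoint x t = iota_pt (push x t).
Proof.
rewrite /iota_pt -rpoint_pull.
have -> // : pull x (mono_id n : std_simplex n n) = x.
exact: mono_ext.
Qed.

Lemma iota_bary (p : realS) : iota_pt (bary p) = p.
Proof. by have [m [x [t ->]]] := rpoint_surj p; rewrite bary_rpoint rpoint_std. Qed.

Lemma bary_iota (t : simplex n) : bary (iota_pt t) = t.
Proof. by rewrite bary_rpoint push_id. Qed.

End StandardSimplex.

Lemma std_map_iota m n (b : mono m n) (t : simplex m) :
  realization_map R (std_map b) (iota_pt t) = iota_pt (push b t).
Proof.
rewrite realization_map_rpoint -(rpoint_std (b : std_simplex n m) t).
have -> // : std_map b m (mono_id m) = b.
exact: mono_ext.
Qed.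

End Realization.

(** * Contractible spaces and weak homotopy equivalences *)
Lemma closed_cover_continuous (X Y : topologicalType) (I : finType)
    (C : I -> set X) (f : I -> X -> Y) (g : X -> Y) :
  (forall i, closed (C i)) -> (forall x, exists i, C i x) ->
  (forall i, continuous (f i)) -> (forall i x, C i x -> g x = f i x) ->
  continuous g.
Proof.
move=> clC covC cf gf x U gU.
have : \forall y \near x, forall i, C i y -> U (f i y).
  apply: filter_forall => i; have [Cx|nCx] := pselect (C i x).
    have fU : nbhs (f i x) U by rewrite -gf.
    by have : nbhs x (f i @^-1` U) := cf i x U fU; apply: filterS.
  have : nbhs x (~` C i) by exact: open_nbhs_nbhs (conj (closed_openC (clC i)) nCx).
  by apply: filterS => y.
apply: filterS => y yU; have [i Cy] := covC y.
by rewrite /= (gf i)//; exact: yU.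
Qed.

Section Contractible.
Context {R : realType}.
Local Notation cube := (cube R).

(** The homotopy is parametrized by the whole line, which is locally compact and
    spares restrictions to the unit interval. It need not fix the base point. *)
Definition contractible (X : topologicalType) : Prop :=
  exists (c : X) (H : X * R -> X),
    [/\ continuous H, forall y, H (y, 0) = y & forall y, H (y, 1) = c].

Lemma cubeP n (t : cube n) i : 0 <= val t 0 i <= 1.
Proof. by case: t => t tP; exact: (set_mem tP). Qed.

Lemma cube_coord_continuous n (i : 'I_n) :
  continuous (fun t : cube n => val t 0 i).
Proof.
apply: (@continuous_compT _ _ _ (fun t : cube n => val t)
  (fun M : 'rV[R]_n => M 0 i)).
  exact: val_continuous.
exact: coord_continuous.
Qed.

Definition stretch_coord (s x : R) : R := clamp (2^-1 + (1 + s) * (x - 2^-1)).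

Lemma stretch_in n (s : R) (t : cube n) :
  \row_i stretch_coord s (val t 0 i) \in
    [set t : 'rV[R]_n | forall i, 0 <= t 0 i <= 1].
Proof. by apply: mem_set => i; rewrite mxE clamp_ge0 clamp_le1. Qed.

Definition stretch n (s : R) (t : cube n) : cube n :=
  exist _ (\row_i stretch_coord s (val t 0 i)) (stretch_in s t).

(** Distance to the boundary, for the supremum norm. The default value 1 makes
    the unique point of the 0-cube, which has no boundary, deep. *)
Definition depth n (t : cube n) : R :=
  \big[Num.min/1]_i Num.min (val t 0 i) (1 - val t 0 i).

Lemma stretch_continuous n :
  continuous (fun st : R * cube n => stretch st.1 st.2).
Proof.
apply: set_type_continuous; apply: row_continuous => i.
rewrite (_ : (fun _ => _) = fun st : R * cube n =>
  clamp (2^-1 + (1 + st.1) * (val st.2 0 i - 2^-1))); last first.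
  by apply/funext => st; rewrite mxE.
apply: (@continuous_compT _ _ _ _ clamp _ clamp_continuous).
apply: continuousD_fun; first exact: cst_continuous.
apply: continuousM_fun; first (apply: continuousD_fun; first exact: cst_continuous).
  by move=> st; exact: cvg_fst.
apply: continuousB_fun; last exact: cst_continuous.
apply: (@continuous_compT _ _ _ snd (fun t : cube n => val t 0 i)).
  by move=> st; exact: cvg_snd.
exact: cube_coord_continuous.
Qed.

Lemma depth_continuous n : continuous (@depth n).
Proof.
apply: continuous_bigmin_fun => i _.
apply: min_fun_continuous; first exact: cube_coord_continuous.
by apply: continuousB_fun; [exact: cst_continuous | exact: cube_coord_continuous].
Qed.

Lemma depth_ge0 n (t : cube n) : 0 <= depth t.
Proof.
apply: le_bigmin => // i _; rewrite le_min subr_ge0.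
by case/andP: (cubeP t i) => -> ->.
Qed.

Lemma depth_boundary n (t : cube n) : on_boundary t -> depth t = 0.
Proof.
move=> [i ti]; apply/eqP; rewrite eq_le depth_ge0 andbT.
apply: (@bigmin_inf _ _ _ _ i) => //.
by case: ti => ->; rewrite ?subrr ge_min lexx ?orbT.
Qed.

Lemma stretch_boundary n s (t : cube n) : 0 <= s -> on_boundary t ->
  on_boundary (stretch s t).
Proof.
move=> s0 [i ti]; exists i; rewrite /= mxE /stretch_coord.
by case: ti => ->; [left; apply: clamp_le0 | right; apply: clamp_ge1]; lra.
Qed.

(** The stretching of factor 2 about the centre, clamped to the cube, squeezes
    the collar of width 1/4 into the boundary. *)
Lemma stretch_depth n (t : cube n) : depth t < 4^-1 -> on_boundary (stretch 1 t).
Proof.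
move=> dt; have : exists i, Num.min (val t 0 i) (1 - val t 0 i) < 4^-1.
  apply: contrapT => /forallNP h; move: dt; apply/negP; rewrite -leNgt.
  apply: le_bigmin => [|i _]; first by lra.
  by rewrite leNgt; apply/negP.
case=> i ti; exists i; rewrite /= mxE /stretch_coord.
by move: ti; rewrite gt_min => /orP[] ti;
  [left; apply: clamp_le0 | right; apply: clamp_ge1]; lra.
Qed.

Lemma stretch0 n (t : cube n) : stretch 0 t = t.
Proof.
apply: val_inj; apply/rowP => i; rewrite mxE /stretch_coord.
by rewrite addr0 mul1r subrKC clamp_id ?cubeP.
Qed.

Section Fill.
Variables (X : topologicalType) (c : X) (H : X * R -> X).
Hypothesis cH : continuous H.
Hypothesis H0 : forall y, H (y, 0) = y.
Hypothesis H1 : forall y, H (y, 1) = c.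

(** A homotopy of [g] relative to the boundary that erases [g]: during the first
    unit of time the cube is stretched, until [g] is constant on a collar;
    during the second the contraction is applied, more and more along the collar
    and completely inside. As the collar only shows the track of the base point,
    the final map does not depend on [g]. *)
Definition spread n (g : continuousType (cube n) X) (s : R) (t : cube n) : X :=
  H (g (stretch (clamp s) t), Num.min (clamp (s - 1)) (4 * depth t)).

Lemma spread_continuous n (g : continuousType (cube n) X) (Y : topologicalType)
    (s : Y -> R) (t : Y -> cube n) : continuous s -> continuous t ->
  continuous (fun y => spread g (s y) (t y)).
Proof.
move=> cs ct.
apply: (@continuous_compT _ _ _ _ H _ cH); apply: continuous_pair.
  apply: (@continuous_compT _ _ _ _ g); last exact: cts_fun.
  apply: (@continuous_compT _ _ _ (fun y => (clamp (s y), t y))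
    (fun st => stretch st.1 st.2)); last exact: stretch_continuous.
  apply: continuous_pair => //.
  exact: (@continuous_compT _ _ _ s clamp cs clamp_continuous).
apply: min_fun_continuous.
  apply: (@continuous_compT _ _ _ (fun y => s y - 1) clamp _ clamp_continuous).
  by apply: continuousB_fun => //; exact: cst_continuous.
apply: continuousM_fun; first exact: cst_continuous.
exact: (@continuous_compT _ _ _ t (@depth n) ct (@depth_continuous n)).
Qed.

Lemma spread0 n (g : continuousType (cube n) X) t : spread g 0 t = g t.
Proof.
rewrite /spread clamp_le0// stretch0 clamp_le0 ?sub0r ?lerN10//.
by rewrite min_l ?H0// mulr_ge0// depth_ge0.
Qed.

Lemma spread_boundary n x (g : continuousType (cube n) X) s t :
  based x g -> on_boundary t -> spread g s t = x.
Proof.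
move=> bg bt; rewrite /spread depth_boundary// mulr0 min_r ?clamp_ge0// H0.
by apply: bg; apply: stretch_boundary => //; exact: clamp_ge0.
Qed.

Lemma spread2 n x (g0 g1 : continuousType (cube n) X) t :
  based x g0 -> based x g1 -> spread g0 2 t = spread g1 2 t.
Proof.
move=> b0 b1.
have [le12 le121] : (1 : R) <= 2 /\ (1 : R) <= 2 - 1 by split; lra.
rewrite /spread !clamp_ge1//.
have [dt|dt] := ltP (depth t) 4^-1.
  by rewrite b0 ?b1//; exact: stretch_depth.
by rewrite min_l ?H1//; lra.
Qed.

(** Two based maps have the same final spread, so one spread followed by the
    reverse of the other joins them. *)
Lemma contraction_based_homotopic n x (g0 g1 : continuousType (cube n) X) :
  based x g0 -> based x g1 -> based_homotopic x g0 g1.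
Proof.
move=> b0 b1.
pose G (st : unit_interval R * cube n) :=
  if val st.1 <= 2^-1 then spread g0 (4 * val st.1) st.2
  else spread g1 (4 * (1 - val st.1)) st.2.
have cval : continuous (fun st : unit_interval R * cube n => val st.1).
  apply: (@continuous_compT _ _ _ fst (fun s : unit_interval R => val s)).
    by move=> st; exact: cvg_fst.
  exact: val_continuous.
have csnd : continuous (fun st : unit_interval R * cube n => st.2).
  by move=> st; exact: cvg_snd.
have cG : continuous G.
  pose C (b : bool) : set (unit_interval R * cube n)%type :=
    if b then [set st | val st.1 <= 2^-1] else [set st | 2^-1 <= val st.1].
  pose f (b : bool) (st : unit_interval R * cube n) :=
    if b then spread g0 (4 * val st.1) st.2
    else spread g1 (4 * (1 - val st.1)) st.2.
  apply: (@closed_cover_continuous _ _ _ C f).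
  - case.
      apply: (@preimage_closed _ _
        (fun st : unit_interval R * cube n => val st.1) [set x | x <= 2^-1]).
        by move=> y _; exact: cval.
      exact: closed_le.
    apply: (@preimage_closed _ _
      (fun st : unit_interval R * cube n => val st.1) [set x | 2^-1 <= x]).
      by move=> y _; exact: cval.
    exact: closed_ge.
  - move=> st; case: (leP (val st.1) 2^-1) => h.
      by exists true.
    by exists false; exact: ltW.
  - case; apply: spread_continuous => //; apply: continuousM_fun => //.
    + exact: cst_continuous.
    + exact: cst_continuous.
    + by apply: continuousB_fun => //; exact: cst_continuous.
  - case=> st h; rewrite /G.
      by have -> : val st.1 <= 2^-1 := h.
    have {}h : 2^-1 <= val st.1 := h.
    rewrite [RHS](_ : _ = spread g1 (4 * (1 - val st.1)) st.2)//.
    case: ifPn => // h'; have -> : val st.1 = 2^-1 by apply/eqP; rewrite eq_le h h'.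
    (* At half time both spreads have reached their common final map. *)
    rewrite [4 * 2^-1](_ : _ = 2); last by lra.
    rewrite [4 * (1 - 2^-1)](_ : _ = 2); last by lra.
    exact: spread2 b0 b1.
exists (mkcts cG); split=> s t.
- by move=> s0; rewrite /= /mkcts /G /= s0 invr_ge0 ler0n mulr0 spread0.
- move=> s1; rewrite /= /mkcts /G /= s1 ifF ?subrr ?mulr0 ?spread0//.
  by apply/negbTE; rewrite -ltNge; lra.
- by move=> bt; rewrite /= /mkcts /G; case: ifP => _; rewrite (@spread_boundary _ x).
Qed.

End Fill.

Lemma contractible_weak_equivalence (X Y : topologicalType)
    (f : continuousType X Y) :
  contractible X -> contractible Y -> weak_homotopy_equivalence R f.
Proof.
move=> [c [H [cH H0 H1]]] [d [G [cG G0 G1]]].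
split; first by move=> _; exists; exact: c.
move=> n x; split=> [g0 g1 b0 b1 _|h bh].
  exact: (contraction_based_homotopic cH H0 H1).
exists (cst x) => //.
by apply: (contraction_based_homotopic cG G0 G1) => // t _.
Qed.

End Contractible.

(** * Simplicial sets with a cone operator *)
Section Cone.
Context {R : realType}.
Local Notation simplex := (simplex R).

(** A simplex of dimension [n.+1] is the cone on its face opposite to the vertex
    0; the vertex 0 is the apex, and [cone a] extends [a] by fixing the apex. *)
Definition cone_fun m n (a : mono m n) (i : 'I_m.+2) : 'I_n.+2 :=
  if unlift ord0 i is Some i' then lift ord0 (a i') else ord0.

Lemma cone_funS m n (a : mono m n) i :
  cone_fun a (lift ord0 i) = lift ord0 (a i).
Proof. by rewrite /cone_fun liftK. Qed.

Lemma cone_fun0 m n (a : mono m n) : cone_fun a ord0 = ord0.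
Proof. by rewrite /cone_fun unlift_none. Qed.

Lemma cone_homo m n (a : mono m n) :
  {homo cone_fun a : i j / (i <= j)%N}.
Proof.
move=> i j; case: (unliftP ord0 i) => [i'|] ->; last by rewrite cone_fun0.
case: (unliftP ord0 j) => [j'|] -> //.
by rewrite !cone_funS !lift0 !ltnS; exact: mono_homo.
Qed.

Definition cone m n (a : mono m n) : mono m.+1 n.+1 := Mono (@cone_homo m n a).

Lemma base_homo n : {homo (lift ord0 : 'I_n.+1 -> 'I_n.+2) : i j / (i <= j)%N}.
Proof. by move=> i j; rewrite !lift0. Qed.

Definition base n : mono n n.+1 := Mono (@base_homo n).

Definition apex n : mono 0 n := @Mono 0 n (fun=> ord0) (fun _ _ _ => leqnn _).

Definition cone_coord (r : R) n (t : simplex n) (j : 'I_n.+2) : R :=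
  if unlift ord0 j is Some i then (1 - clamp r) * val t 0 i else clamp r.

Lemma cone_coord0 r n (t : simplex n) : cone_coord r t ord0 = clamp r.
Proof. by rewrite /cone_coord unlift_none. Qed.

Lemma cone_coordS r n (t : simplex n) i :
  cone_coord r t (lift ord0 i) = (1 - clamp r) * val t 0 i.
Proof. by rewrite /cone_coord liftK. Qed.

Lemma cone_coord_ge0 r n (t : simplex n) j : 0 <= cone_coord r t j.
Proof.
case: (unliftP ord0 j) => [i|] ->; rewrite ?cone_coord0 ?cone_coordS ?clamp_ge0//.
by rewrite mulr_ge0 ?simplex_ge0// subr_ge0 clamp_le1.
Qed.

Lemma cone_coord_sum r n (t : simplex n) : \sum_j cone_coord r t j = 1.
Proof.
rewrite big_ord_recl cone_coord0; under eq_bigr => i _ do rewrite cone_coordS.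
by rewrite -mulr_sumr simplex_sum1 mulr1 subrKC.
Qed.

(** The point at time [r] on the segment from [t], in the base, to the apex. *)
Definition cone_pt r n (t : simplex n) : simplex n.+1 :=
  mk_simplex (@cone_coord_ge0 r n t) (cone_coord_sum r t).

Lemma cone_pt0 r n (t : simplex n) : val (cone_pt r t) 0 ord0 = clamp r.
Proof. by rewrite mk_simplexE cone_coord0. Qed.

Lemma cone_ptS r n (t : simplex n) i :
  val (cone_pt r t) 0 (lift ord0 i) = (1 - clamp r) * val t 0 i.
Proof. by rewrite mk_simplexE cone_coordS. Qed.

Lemma push_cone0 m n (a : mono m n) (w : simplex m.+1) :
  val (push (cone a) w) 0 ord0 = val w 0 ord0.
Proof.
rewrite pushE (big_pred1 ord0)// => j /=.
by case: (unliftP ord0 j) => [i|] ->; rewrite ?cone_funS ?cone_fun0.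
Qed.

Lemma push_coneS m n (a : mono m n) (w : simplex m.+1) j :
  val (push (cone a) w) 0 (lift ord0 j) =
  \sum_(i | a i == j) val w 0 (lift ord0 i).
Proof.
rewrite pushE big_mkcond big_ord_recl /= cone_fun0 add0r [RHS]big_mkcond.
by apply: eq_bigr => i _; rewrite cone_funS (inj_eq lift_inj).
Qed.

Lemma push_cone_pt m n (a : mono m n) r (t : simplex m) :
  push (cone a) (cone_pt r t) = cone_pt r (push a t).
Proof.
apply: simplex_ext => j; case: (unliftP ord0 j) => [i|] ->.
  rewrite push_coneS cone_ptS pushE mulr_sumr.
  by apply: eq_bigr => k _; rewrite cone_ptS.
by rewrite push_cone0 !cone_pt0.
Qed.

Lemma cone_pt_base n (t : simplex n) : cone_pt 0 t = push (base n) t.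
Proof.
apply: simplex_ext => j; case: (unliftP ord0 j) => [i|] ->.
  by rewrite cone_ptS clamp_le0// subr0 mul1r pushE (big_pred1 i).
by rewrite cone_pt0 clamp_le0// pushE big_pred0.
Qed.

Lemma simplex0_coord (t : simplex 0) : val t 0 ord0 = 1.
Proof. by rewrite -(simplex_sum1 t) big_ord1. Qed.

Lemma simplex0_eq (t t' : simplex 0) : t = t'.
Proof. by apply: simplex_ext => i; rewrite ord1 !simplex0_coord. Qed.

Definition simplex0 : simplex 0.
Proof.
apply: (@mk_simplex R 0 (fun=> 1)) => [i|]; first exact: ler01.
by rewrite big_ord1.
Defined.

Lemma cone_pt_apex n (t : simplex n) : cone_pt 1 t = push (apex n.+1) simplex0.
Proof.
apply: simplex_ext => j; case: (unliftP ord0 j) => [i|] ->.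
  by rewrite cone_ptS clamp_ge1// subrr mul0r pushE big_pred0.
rewrite cone_pt0 clamp_ge1// pushE (big_pred1 ord0) ?simplex0_coord// => k.
by rewrite ord1.
Qed.

Lemma cone_pt_continuous n :
  continuous (fun tr : simplex n * R => cone_pt tr.2 tr.1).
Proof.
have c2 : continuous (fun tr : simplex n * R => clamp tr.2).
  apply: (@continuous_compT _ _ _ snd clamp); last exact: clamp_continuous.
  by move=> tr; exact: cvg_snd.
apply: simplex_continuous => j; case: (unliftP ord0 j) => [i|] ->.
  rewrite (_ : (fun _ => _) = fun tr : simplex n * R =>
      (1 - clamp tr.2) * val tr.1 0 i).
    apply: continuousM_fun; first by apply: continuousB_fun => //; exact: cst_continuous.
    apply: (@continuous_compT _ _ _ fst (fun t : simplex n => val t 0 i)).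
      by move=> tr; exact: cvg_fst.
    exact: simplex_coord_continuous.
  by apply/funext => tr; rewrite cone_ptS.
rewrite (_ : (fun _ => _) = fun tr : simplex n * R => clamp tr.2)//.
by apply/funext => tr; rewrite cone_pt0.
Qed.

Section Contraction.
Import ArrowAsCompactOpen.
Variables (K : sset) (s : forall n, K n -> K n.+1) (c : K 0).
Hypothesis s_cone : forall m n (a : mono m n) (x : K n),
  pull (cone a) (s x) = s (pull a x).
Hypothesis s_base : forall n (x : K n), pull (base n) (s x) = x.
Hypothesis s_apex : forall n (x : K n), pull (apex n.+1) (s x) = c.

Let path n (x : K n) (t : simplex n) : R -> realization R K :=
  fun r => rpoint (s x) (cone_pt r t).

Let path_pull m n (a : mono m n) (x : K n) (t : simplex m) :
  path (pull a x) t = path x (push a t).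
Proof. by apply/funext => r; rewrite /path -s_cone rpoint_pull push_cone_pt. Qed.

(** The cone operator [s] puts the n-simplex [x] at the base of a simplex whose
    apex is the fixed vertex [c]; each point of [x] moves to [c] along the segment
    that joins it to the apex. Continuity in both variables is deduced
    from the continuity of the map to the space of paths: the latter can be
    checked on cells, because a realization is a quotient of them. *)
Lemma cone_contractible : @contractible R (realization R K).
Proof.
pose H := uncurry (realization_lift path).
have HE n (x : K n) t r : H (rpoint x t, r) = rpoint (s x) (cone_pt r t).
  by rewrite /H /uncurry realization_liftE.
have cpath n (x : K n) : continuous (fun tr : simplex n * R => path x tr.1 tr.2).
  apply: (@continuous_compT _ _ _ (fun tr : simplex n * R => cone_pt tr.2 tr.1)
    (rpoint (s x))); first exact: cone_pt_continuous.
  exact: rpoint_continuous.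
exists (rpoint c simplex0), H; split.
- apply: continuous_uncurry.
  + exact: locally_compactR.
  + exact: Rhausdorff.
  + apply: realization_lift_continuous => // n x.
    exact: (continuous_curry_fun (cpath n x)).
  + move=> p; have [n [x [t ->]]] := rpoint_surj p.
    rewrite realization_liftE//.
    exact: (proj2 (continuous_curry (cpath n x)) t).
- move=> p; have [n [x [t ->]]] := rpoint_surj p.
  by rewrite HE cone_pt_base -rpoint_pull s_base.
- move=> p; have [n [x [t ->]]] := rpoint_surj p.
  by rewrite HE cone_pt_apex -rpoint_pull s_apex.
Qed.

End Contraction.

End Cone.

(** * Simplices of function complexes; every diagram is fibrant *)
Section Generated.
Context {R : realType} {S : convenient_category}.

Lemma generate_spaceE (X : topologicalType) (U : set (generate_space R S X)) :
  open U = test_open R S (U : set X).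
Proof. by []. Qed.

Lemma generate_counit (X : topologicalType) :
  continuous (id : generate_space R S X -> X).
Proof.
apply/continuousP => U oU; rewrite generate_spaceE => K phi _.
by have /continuousP := @cts_fun _ _ phi; exact.
Qed.

Lemma generate_lift_continuous (X Y : topologicalType) (f : X -> Y) :
  is_generated R S X -> continuous f -> continuous (f : X -> generate_space R S Y).
Proof.
move=> gX cf; apply/continuousP => U; rewrite generate_spaceE => oU.
apply: gX => K phi tK.
have cfphi : continuous (f \o phi).
  by apply: continuous_compT => //; exact: cts_fun.
exact: (oU K (mkcts cfphi) tK).
Qed.

Lemma unit_interval_generated : is_generated R S (unit_interval R).
Proof.
by move=> U /(_ _ idfun (@unit_interval_test R S)); rewrite preimage_id.
Qed.

End Generated.

Section HomPoints.
Context {R : realType} {S : convenient_category} {D : category}.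
Implicit Types T X Y : diagram R S D.

(** A simplex of a function complex is a family of maps parametrized by
    barycentric coordinates; [mk_hom] is the converse of this evaluation. *)
Definition heval T Y n (h : hom T Y n) (t : simplex R n) d (x : T d) : Y d :=
  h d (iota_pt t, x).

Lemma hevalE T Y n (h : hom T Y n) d p (x : T d) :
  h d (p, x) = heval h (bary p) x.
Proof. by rewrite /heval iota_bary. Qed.

Lemma heval_ext T Y n (h h' : hom T Y n) :
  (forall t d (x : T d), heval h t x = heval h' t x) -> h = h'.
Proof. by move=> hh'; apply: dmap_ext => d [p x]; rewrite !hevalE hh'. Qed.

Lemma heval_pull T Y m n (a : mono m n) (h : hom T Y n) t d (x : T d) :
  heval (pull a h) t x = heval h (push a t) x.
Proof. by rewrite /heval -std_map_iota. Qed.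

Lemma heval_arrow T Y n (h : hom T Y n) t a b (u : arrow a b) (x : T a) :
  heval h t (diag_arrow T u x) = diag_arrow Y u (heval h t x).
Proof. by rewrite /heval -dmap_nat. Qed.

Lemma heval_continuous T Y n (h : hom T Y n) d (V : topologicalType)
    (t : V -> simplex R n) (x : V -> T d) :
  is_generated R S V -> continuous t -> continuous x ->
  continuous (fun v => heval h (t v) (x v)).
Proof.
move=> gV ct cx.
apply: (@continuous_compT _ _ _
  (fun v => (iota_pt (t v), x v) : tensor (std_simplex n) T d) (h d)).
  apply: generate_lift_continuous => //; apply: continuous_pair => //.
  apply: (@continuous_compT _ _ _ t) => //; exact: iota_continuous.
exact: cts_fun.
Qed.

Lemma tensor_fst_continuous T n d :
  continuous (fun q : tensor (std_simplex n) T d => bary q.1).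
Proof.
apply: (@continuous_compT _ (realization R (std_simplex n) * T d)%type _
  (id : tensor (std_simplex n) T d -> (realization R (std_simplex n) * T d)%type)
  (fun q => bary q.1)); first exact: generate_counit.
apply: (@continuous_compT _ _ _ fst); last exact: bary_continuous.
by move=> q; exact: cvg_fst.
Qed.

Lemma tensor_snd_continuous T n d :
  continuous (fun q : tensor (std_simplex n) T d => q.2).
Proof.
apply: (@continuous_compT _ (realization R (std_simplex n) * T d)%type _
  (id : tensor (std_simplex n) T d -> (realization R (std_simplex n) * T d)%type)
  snd); first exact: generate_counit.
by move=> q; exact: cvg_snd.
Qed.

Section MakeHom.
Variables (T Y : diagram R S D) (n : nat).
Variable (w : forall d, simplex R n -> T d -> Y d).
Hypothesis w_cont : forall d,
  continuous (fun q : tensor (std_simplex n) T d => w (bary q.1) q.2).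
Hypothesis w_arrow : forall t a b (u : arrow a b) (x : T a),
  w t (diag_arrow T u x) = diag_arrow Y u (w t x).

Let mk_hom_nat a b (u : arrow a b) (q : tensor (std_simplex n) T a) :
  mkcts (w_cont (d := b)) (diag_arrow (tensor (std_simplex n) T) u q) =
  diag_arrow Y u (mkcts (w_cont (d := a)) q).
Proof. exact: w_arrow. Qed.

Definition mk_hom : hom T Y n :=
  @DMap R S D (tensor (std_simplex n) T) Y (fun d => mkcts (w_cont (d := d)))
    mk_hom_nat.

Lemma heval_mk_hom t d (x : T d) : heval mk_hom t x = w t x.
Proof. by rewrite /heval /= /mkcts /= bary_iota. Qed.

End MakeHom.
End HomPoints.

Section Fibrant.
Context {R : realType} {S : convenient_category} {D : category}.

(** The map sends a vertex to the last vertex of [P] below it, if any, and to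
    the first vertex of [P] otherwise. *)
Lemma mono_retraction n (P : pred 'I_n.+1) (i0 : 'I_n.+1) : P i0 ->
  exists e : mono n n, (forall i, P (e i)) /\ (forall i, P i -> e i = i).
Proof.
move=> Pi0; case: (arg_minnP (fun i : 'I_n.+1 => i : nat) Pi0) => j0 Pj0 j0min.
pose Q (i : 'I_n.+1) (j : 'I_n.+1) := P j && (j <= maxn i j0)%N.
have Qj0 i : Q i j0 by rewrite /Q Pj0 leq_maxr.
pose e i := [arg max_(j > j0 | Q i j) (j : nat)].
have eP i : Q i (e i) /\ forall j, Q i j -> (j <= e i)%N.
  by rewrite /e; case: arg_maxnP => // j Qj jmax; split.
have e_homo : {homo e : i j / (i <= j)%N}.
  move=> i j ij; apply: (eP j).2; have /andP[Pe le] := (eP i).1.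
  by rewrite /Q Pe (leq_trans le)// geq_max leq_maxr andbT leq_max ij.
exists (Mono e_homo); split=> [i|i Pi] /=; first by case/andP: (eP i).1.
have mi : maxn i j0 = i by apply/maxn_idPl; exact: j0min.
apply/val_inj/eqP; rewrite eqn_leq (eP i).2 /Q ?Pi ?mi ?leqnn// andbT.
by have /andP[_] := (eP i).1; rewrite mi.
Qed.

Lemma push_fixed n (e : mono n n) (t : simplex R n) :
  (forall i, 0 < val t 0 i -> e i = i) -> push e t = t.
Proof.
move=> et; apply: simplex_ext => j; rewrite pushE.
rewrite [LHS]big_mkcond (bigD1 j)//= big1 ?addr0 => [|i ij].
  have [tj|] := ltP 0 (val t 0 j); first by rewrite et// eqxx.
  move=> tj; have -> : val t 0 j = 0 by apply/eqP; rewrite eq_le tj simplex_ge0.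
  by rewrite if_same.
case: ifP => // /eqP eij; apply/eqP; rewrite eq_le simplex_ge0 andbT leNgt.
by apply/negP => ti; move: ij; rewrite -eij et// eqxx.
Qed.

Section HornRetraction.
Variables (n : nat) (k : 'I_n.+2).
Implicit Types (t : simplex R n.+1).

Definition hmin t : R := \big[Num.min/1]_(i | i != k) val t 0 i.

Definition hret_coord t i : R :=
  if i == k then val t 0 i + n.+1%:R * hmin t else val t 0 i - hmin t.

Lemma hmin_ge0 t : 0 <= hmin t.
Proof. by apply: le_bigmin => // i _; exact: simplex_ge0. Qed.

Lemma hret_coord_ge0 t i : 0 <= hret_coord t i.
Proof.
rewrite /hret_coord; case: ifPn => ik.
  by rewrite addr_ge0 ?simplex_ge0// mulr_ge0// hmin_ge0.
by rewrite subr_ge0; exact: bigmin_le_cond.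
Qed.

Lemma hret_coord_sum t : \sum_i hret_coord t i = 1.
Proof.
rewrite (bigD1 k)//= /hret_coord eqxx.
under eq_bigr => i /negbTE -> do [].
rewrite big_split/= sumr_const cardC1 card_ord mulNrn mulr_natl.
by rewrite addrACA subrr addr0 -(simplex_sum1 t) [RHS](bigD1 k).
Qed.

(** The retraction of the simplex onto the horn, along the direction that
    decreases all coordinates but the [k]-th one at the same speed. *)
Definition hret t : simplex R n.+1 :=
  mk_simplex (hret_coord_ge0 t) (hret_coord_sum t).

Lemma hretE t i : val (hret t) 0 i = hret_coord t i.
Proof. exact: mk_simplexE. Qed.

Lemma hmin_continuous : continuous hmin.
Proof. by apply: continuous_bigmin_fun => i _; exact: simplex_coord_continuous. Qed.

Lemma hret_continuous : continuous hret.
Proof.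
apply: simplex_continuous => i.
rewrite (_ : (fun _ => _) = hret_coord^~ i); last by apply/funext => t; rewrite hretE.
rewrite /hret_coord; case: (i == k).
  apply: continuousD_fun; first exact: simplex_coord_continuous.
  by apply: continuousM_fun; [exact: cst_continuous | exact: hmin_continuous].
by apply: continuousB_fun; [exact: simplex_coord_continuous | exact: hmin_continuous].
Qed.

Lemma hret_horn t : exists2 i, i != k & val (hret t) 0 i = 0.
Proof.
have [j0 j0k] : exists j, j != k.
  by exists (lift k ord0); rewrite eq_sym neq_lift.
have [i ik it] := eq_bigmin j0 (fun i => i != k) (fun i => val t 0 i) j0k
  (fun i _ => simplex_le1 t i).
by exists i => //; rewrite hretE /hret_coord (negbTE ik) -it subrr.
Qed.

Lemma hret_id t i : i != k -> val t 0 i = 0 -> hret t = t.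
Proof.
move=> ik ti; have m0 : hmin t = 0.
  apply/eqP; rewrite eq_le hmin_ge0 andbT.
  by apply: (@bigmin_inf _ _ _ _ i) => //; rewrite ti.
by apply: simplex_ext => j; rewrite hretE /hret_coord m0 mulr0 addr0 subr0 if_same.
Qed.

Lemma avoid_retraction (j : 'I_n.+2) : exists e : mono n.+1 n.+1,
  (forall i, e i != j) /\ (forall i, i != j -> e i = i).
Proof.
apply: (@mono_retraction _ [pred i | i != j] (lift j ord0)).
by rewrite inE eq_sym neq_lift.
Qed.

(** A monotone retraction of the vertices onto those different from [j]: it is a
    simplex of the horn of full dimension, which makes it convenient to evaluate
    a map defined on the horn at the points of the face opposite to [j] without
    renumbering vertices. *)
Definition avoid j : mono n.+1 n.+1 := projT1 (cid (avoid_retraction j)).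

Lemma avoid_neq j i : avoid j i != j.
Proof. by rewrite /avoid; case: cid => e []. Qed.

Lemma avoid_id j i : i != j -> avoid j i = i.
Proof. by rewrite /avoid; case: cid => e [_] /= h; exact: h. Qed.

Definition avoid_horn (j : {j | j != k}) : horn k n.+1 :=
  exist _ (avoid (val j)) (ex_intro2 _ _ (val j) (valP j) (avoid_neq (val j))).

Section Value.
Variables (T Y : diagram R S D) (u : smap (horn k) (hom T Y)).

(** The value of [u] at a point of the horn does not depend on the simplex used
    to reach that point. Precomposing [x] with a retraction onto the vertices that
    carry [t] does not move the point, and [avoid j] fixes the vertices reached
    by this composite. *)
Lemma horn_value m (x : horn k m) (t : simplex R m) (j : {j | j != k}) d (y : T d) :
  val (push (sval x) t) 0 (val j) = 0 ->
  heval (u m x) t y = heval (u n.+1 (avoid_horn j)) (push (sval x) t) y.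
Proof.
move=> xtj; have [i0 ti0] := simplex_pos t.
have [e [eP e_id]] := @mono_retraction m [pred i | 0 < val t 0 i] i0 ti0.
have et : push e t = t by apply: push_fixed => i ti; exact: e_id.
rewrite -[in LHS]et -heval_pull -smap_pull.
have -> : pull e x = pull (mono_comp (sval x) e) (avoid_horn j).
  apply: eq_exist; apply: mono_ext => i /=.
  rewrite avoid_id//; apply/eqP => xj.
  by have := push_pos (sval x) (eP i); rewrite xj xtj ltxx.
by rewrite smap_pull heval_pull push_comp et.
Qed.

Definition horn_filler d (t : simplex R n.+1) (y : T d) : Y d :=
  let: exist2 j jk _ := cid2 (hret_horn t) in
  heval (u n.+1 (avoid_horn (exist _ j jk))) (hret t) y.

Lemma horn_fillerE d (t : simplex R n.+1) (y : T d) (j : {j | j != k}) :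
  val (hret t) 0 (val j) = 0 ->
  horn_filler t y = heval (u n.+1 (avoid_horn j)) (hret t) y.
Proof.
move=> tj; rewrite /horn_filler; case: cid2 => i ik ti.
have fixi : push (avoid i) (hret t) = hret t.
  apply: push_fixed => l tl; apply: avoid_id; apply/eqP => li.
  by move: tl; rewrite li ti ltxx.
by rewrite (@horn_value _ (avoid_horn (exist _ i ik)) _ j) ?fixi.
Qed.

(** On the closed set where the retraction lands in the face opposite to [j],
    the filler is the value of one simplex, which is continuous everywhere. *)
Lemma horn_filler_continuous d :
  continuous (fun q : tensor (std_simplex n.+1) T d => horn_filler (bary q.1) q.2).
Proof.
have cret : continuous (fun q : tensor (std_simplex n.+1) T d => hret (bary q.1)).
  apply: (@continuous_compT _ _ _ (fun q : tensor (std_simplex n.+1) T d => bary q.1)).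
    exact: tensor_fst_continuous.
  exact: hret_continuous.
apply: (@closed_cover_continuous _ _ {j | j != k}
  (fun j => [set q : tensor (std_simplex n.+1) T d |
    val (hret (bary q.1)) 0 (val j) = 0])
  (fun j q => heval (u n.+1 (avoid_horn j)) (hret (bary q.1)) q.2)).
- move=> j.
  apply: (@preimage_closed _ _ (fun q : tensor (std_simplex n.+1) T d =>
    val (hret (bary q.1)) 0 (val j)) [set x | x = 0]); last exact: closed_eq.
  move=> q _; apply: (@continuous_compT _ _ _ _
    (fun t : simplex R n.+1 => val t 0 (val j)) cret).
  exact: simplex_coord_continuous.
- by move=> q; have [j jk tj] := hret_horn (bary q.1); exists (exist _ j jk).
- move=> j; apply: heval_continuous => //.
    exact: spaceP.
  exact: tensor_snd_continuous.
- by move=> j q tj; exact: horn_fillerE.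
Qed.

Lemma horn_filler_arrow t a b (v : arrow a b) (y : T a) :
  horn_filler t (diag_arrow T v y) = diag_arrow Y v (horn_filler t y).
Proof. by rewrite /horn_filler; case: cid2 => j jk _; rewrite heval_arrow. Qed.

Definition horn_hom : hom T Y n.+1 :=
  mk_hom horn_filler_continuous horn_filler_arrow.

Lemma heval_horn_hom m (x : horn k m) (t : simplex R m) d (y : T d) :
  heval horn_hom (push (sval x) t) y = heval (u m x) t y.
Proof.
rewrite heval_mk_hom; have [j jk xj] := svalP x.
have tj : val (push (sval x) t) 0 j = 0.
  by rewrite pushE big_pred0// => i; exact/negbTE.
have rt := hret_id jk tj.
rewrite (@horn_fillerE _ _ _ (exist _ j jk)); last by rewrite rt.
by rewrite rt; apply/esym; apply: horn_value.
Qed.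

End Value.
End HornRetraction.

(** The topological simplex retracts onto its horns, so that maps out of a horn
    extend, whatever the target. *)
Lemma every_diagram_fibrant (Y : diagram R S D) : fibrant Y.
Proof.
move=> T _ n k u v _.
have wP l m (a : mono l m) (x : std_simplex n.+1 m) :
    pull (pull a x : mono l n.+1) (horn_hom u) =
    pull a (pull (x : mono m n.+1) (horn_hom u)).
  exact: (pull_comp a (x : mono m n.+1) (horn_hom u)).
exists (@SMap (std_simplex n.+1) (hom T Y)
  (fun m x => pull (x : mono m n.+1) (horn_hom u)) wP).
split=> m x.
  apply: heval_ext => t d y; rewrite heval_pull; exact: heval_horn_hom.
apply: heval_ext => t d y.
by case: (heval _ t y); case: (heval _ t y).
Qed.

End Fibrant.

(** * Alexandrov spaces and orbits *)
Definition alexandrov (P : Type) (le : P -> P -> Prop) : Type := P.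

Section Alexandrov.
Variables (P : Type) (le : P -> P -> Prop).

Definition upward_closed (U : set P) : Prop := forall x y, le x y -> U x -> U y.

Let upward_closedT : upward_closed [set: P]. Proof. by []. Qed.

Let upward_closedI : setI_closed upward_closed.
Proof.
by move=> A B uA uB x y xy [Ax Bx]; split; [exact: uA xy Ax | exact: uB xy Bx].
Qed.

Let upward_closed_bigU (I : Type) (f : I -> set P) :
  (forall i, upward_closed (f i)) -> upward_closed (\bigcup_i f i).
Proof. by move=> uf x y xy [i _ fx]; exists i => //; exact: uf xy fx. Qed.

HB.instance Definition _ := gen_eqMixin (alexandrov le).
HB.instance Definition _ := gen_choiceMixin (alexandrov le).
HB.instance Definition _ := @isOpenTopological.Build (alexandrov le)
  upward_closed upward_closedT upward_closedI upward_closed_bigU.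

Lemma alexandrov_openE (U : set (alexandrov le)) : open U = upward_closed U.
Proof. by []. Qed.

(** If [x] is below [y], the map equal to [x] at 0 and to [y] on the rest of the
    interval is continuous. So a set whose preimages under paths are open is
    upward closed. *)
Lemma alexandrov_generated (R : realType) (S : convenient_category) :
  is_generated R S (alexandrov le).
Proof.
move=> U oU; rewrite alexandrov_openE => x y xy Ux.
pose phi (s : unit_interval R) : alexandrov le := if val s == 0 then x else y.
have cphi : continuous phi.
  apply/continuousP => V; rewrite alexandrov_openE => uV.
  have [Vx|nVx] := pselect (V x).
    rewrite (_ : _ @^-1` _ = setT); first exact: openT.
    by apply/seteqP; split=> // s _; rewrite /phi /=; case: ifP => // _; exact: uV Vx.
  have [Vy|nVy] := pselect (V y); last first.
    rewrite (_ : _ @^-1` _ = set0); first exact: open0.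
    by apply/seteqP; split=> // s; rewrite /phi /=; case: ifP.
  rewrite (_ : _ @^-1` _ = (fun s : unit_interval R => val s) @^-1` [set r | 0 < r]).
    apply: open_comp; last exact: open_gt.
    by move=> s _; exact: val_continuous.
  apply/seteqP; split=> s; rewrite /phi /=.
    by case: eqP => // /eqP s0 _; rewrite lt_def s0; case/andP: (unit_itvP s).
  by move=> s0; rewrite gt_eqF.
have oW : open (to_unit @^-1` (phi @^-1` U)).
  apply: open_comp; first by move=> r _; exact: to_unit_continuous.
  exact: (oU _ (mkcts cphi) (unit_interval_test S)).
have W0 : (to_unit @^-1` (phi @^-1` U)) (0 : R).
  by rewrite /phi /= clamp_le0// eqxx.
have /nbhs_ballP[e /= e0 eW] := open_nbhs_nbhs (conj oW W0).
have : (to_unit @^-1` (phi @^-1` U)) (e / 2).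
  apply: eW; rewrite /ball /= sub0r normrN gtr0_norm ?divr_gt0//.
  by rewrite ltr_pdivrMr// mulr_natr mulr2n ltrDl.
rewrite /phi /= gt_eqF// /clamp lt_max; apply/orP; right.
by rewrite lt_min ltr01 divr_gt0.
Qed.

Definition alexandrov_space (R : realType) (S : convenient_category) :
  space R S := Space (@alexandrov_generated R S).

Hypothesis le_refl : forall x, le x x.
Hypothesis le_trans : forall x y z, le x y -> le y z -> le x z.

Lemma alexandrov_nbhs (x : alexandrov le) : nbhs x [set y | le x y].
Proof.
apply: open_nbhs_nbhs; split; last exact: le_refl.
by rewrite alexandrov_openE => y z yz xy; exact: le_trans xy yz.
Qed.

Lemma alexandrov_continuousP (X : topologicalType) (f : X -> alexandrov le) :
  continuous f <-> forall x, \forall x' \near x, le (f x) (f x').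
Proof.
split=> [cf x|fle x U]; first exact: cf (alexandrov_nbhs (f x)).
rewrite nbhsE => -[V [oV Vfx] VU]; have := fle x; apply: filterS => x' xx'.
by apply: VU; move: oV; rewrite alexandrov_openE; apply; first exact: xx'.
Qed.

End Alexandrov.

Section Orbits.
Context {R : realType} {S : convenient_category} {D : category}.
Implicit Types T X Y : diagram R S D.

Lemma orbit_cocone_constant T (P : space R S) (g : dmap T (const_diagram D P)) :
  is_orbit T -> exists y, forall d (x : T d), g d x = y.
Proof. by move=> /(_ P g)[h [hg _]]; exists (h tt) => d x; rewrite -hg. Qed.

(** Otherwise two distinct maps from the point to a two-point space would both
    extend the empty cocone. *)
Lemma orbit_nonempty T : is_orbit T -> exists d, inhabited (T d).
Proof.
move=> oT; apply: contrapT => /forallNP T0.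
have T0' d (x : T d) : False by apply: (T0 d); exists.
pose B := discrete_space R S bool.
pose g : dmap T (const_diagram D B) :=
  @DMap R S D T (const_diagram D B) (fun=> cst true) (fun _ _ _ _ => erefl).
have [h [_ huniq]] := oT B g.
have tE : h = cst true by apply: huniq => d x; case: (T0' d x).
have fE : h = cst false by apply: huniq => d x; case: (T0' d x).
have : (cst true : continuousType (point_space R S) B) tt = cst false tt.
  by rewrite -tE fE.
by [].
Qed.

Lemma discrete_continuous (C : choiceType) (X : topologicalType)
    (f : discrete_topology C -> X) : continuous f.
Proof. by apply/continuousP => U _; exact: discrete_open. Qed.

Section Discretize.
Variable T : diagram R S D.

Let arrow_fun a b (u : arrow a b) :
  discrete_space R S (T a) -> discrete_space R S (T b) := diag_arrow T u.

Let arrow_cont a b (u : arrow a b) : continuous (arrow_fun u).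
Proof. exact: discrete_continuous. Qed.

Definition discretize : diagram R S D :=
  @Diagram R S D (fun d => discrete_space R S (T d))
    (fun a b u => mkcts (@arrow_cont a b u))
    (fun a x => diag_id x) (fun a b c v u x => diag_comp v u x).

(** A cocone under the discretized diagram is a cocone under the original
    one, once its target is made indiscrete; hence it is constant. *)
Lemma discretize_orbit : is_orbit T -> is_orbit discretize.
Proof.
move=> oT Y g.
(* The Alexandrov topology of the full relation is the indiscrete one. *)
pose le (x y : Y) := True.
have ccont (X : topologicalType) (f : X -> alexandrov le) : continuous f.
  apply/(@alexandrov_continuousP _ le) => // x.
  exact: nearW.
pose I := alexandrov_space le R S.
pose g' : dmap T (const_diagram D I) :=
  @DMap R S D T (const_diagram D I) (fun d => mkcts (@ccont (T d) (g d)))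
    (fun a b u x => dmap_nat g u x).
have [y gy] := @orbit_cocone_constant T I g' oT.
exists (cst y); split=> [d x|h hg]; first by rewrite -(gy d x).
have [d [x]] := orbit_nonempty oT.
apply/continuousEP => -[] /=.
by rewrite -(gy d x); exact/esym/(hg d x).
Qed.

End Discretize.
End Orbits.

(** * The diagram of a large orbit *)
Section Faces.
Context {R : realType}.
Local Notation simplex := (simplex R).

(** The point [t'] lies on the smallest face that contains [t]. *)
Definition in_carrier n (t t' : simplex n) : Prop :=
  forall i, 0 < val t' 0 i -> 0 < val t 0 i.

Lemma in_carrier_push m n (a : mono m n) (t t' : simplex m) :
  in_carrier t t' -> in_carrier (push a t) (push a t').
Proof. by move=> tt' j /push_posP[i <- /tt']; exact: push_pos. Qed.

(** A monotone map sends the carrier of [t] onto the carrier of [push a t]: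
    distribute the weights of [w] along a section of [a] with values in the
    carrier of [t]. *)
Lemma in_carrier_lift m n (a : mono m n) (t : simplex m) (w : simplex n) :
  in_carrier (push a t) w -> exists2 t', in_carrier t t' & push a t' = w.
Proof.
move=> tw; have [i0 ti0] := simplex_pos t.
pose sec j := odflt i0 [pick i | (0 < val t 0 i) && (a i == j)].
have sec_pos j : 0 < val t 0 (sec j).
  by rewrite /sec; case: pickP => //= i /andP[].
have secK j : 0 < val w 0 j -> a (sec j) = j.
  move=> /tw /push_posP[i ai ti]; rewrite /sec; case: pickP => [i' /andP[_ /eqP]//|].
  by move=> /(_ i); rewrite ti ai eqxx.
have t'0 i : 0 <= \sum_(j | sec j == i) val w 0 j.
  by apply: sumr_ge0 => j _; exact: simplex_ge0.
have t'1 : \sum_i \sum_(j | sec j == i) val w 0 j = 1.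
  by rewrite -(simplex_sum1 w) [RHS](partition_big sec xpredT).
exists (mk_simplex t'0 t'1).
  move=> i; rewrite mk_simplexE => h; apply: contrapT => ti; move: h.
  rewrite big_pred0 ?ltxx// => j; apply/negbTE/eqP => ji.
  by apply: ti; rewrite -ji; exact: sec_pos.
apply: simplex_ext => j; rewrite pushE.
under eq_bigr => i _ do rewrite mk_simplexE.
have <- : \sum_(l | a (sec l) == j) val w 0 l =
    \sum_(i | a i == j) \sum_(l | sec l == i) val w 0 l.
  rewrite (partition_big sec (fun i => a i == j))//=.
  apply: eq_bigr => i /eqP ai; apply: eq_bigl => l.
  by case: (sec l =P i) => [->|]; rewrite ?ai ?eqxx ?andbF.
rewrite [LHS]big_mkcond (bigD1 j)//= big1 ?addr0 => [|l lj].
  have [wj|] := ltP 0 (val w 0 j); first by rewrite secK// eqxx.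
  move=> wj; have -> : val w 0 j = 0 by apply/eqP; rewrite eq_le wj simplex_ge0.
  by rewrite if_same.
case: ifP => // /eqP sl; apply/eqP; rewrite eq_le simplex_ge0 andbT leNgt.
by apply/negP => wl; move: lj; rewrite -sl secK// eqxx.
Qed.

Lemma near_in_carrier n (X : topologicalType) (f : X -> simplex n) (x : X) :
  continuous f -> \forall x' \near x, in_carrier (f x') (f x).
Proof.
move=> cf; apply: filter_forall => i.
have [fi|fi] := ltP 0 (val (f x) 0 i); last by apply: nearW.
have cfi : continuous (fun x => val (f x) 0 i).
  exact: (@continuous_compT _ _ _ f (fun t : simplex n => val t 0 i) cf
    (@simplex_coord_continuous _ _ i)).
have pos : nbhs (val (f x) 0 i) [set r | 0 < r].
  exact: open_nbhs_nbhs (conj (@open_gt _ 0) fi).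
have : nbhs x ((fun y => val (f y) 0 i) @^-1` [set r | 0 < r]) := cfi x _ pos.
by apply: filterS => x' fx' _.
Qed.

(** The point [tail_pt w] is the projection of [w] from the apex onto the base.
    As the projection is not defined at the apex, the denominator is bounded
    below, and [tail_coord] puts the missing weight on the first vertex; only the
    points with apex coordinate at most 1/2 matter. *)
Definition tail_scale n (w : simplex n.+1) : R := Num.max (1 - val w 0 ord0) 2^-1.

Definition tail_coord n (w : simplex n.+1) (i : 'I_n.+1) : R :=
  val w 0 (lift ord0 i) / tail_scale w +
  (if i == ord0 then 1 - (1 - val w 0 ord0) / tail_scale w else 0).

Lemma tail_scale_gt0 n (w : simplex n.+1) : 0 < tail_scale w.
Proof. by rewrite lt_max invr_gt0 ltr0n orbT. Qed.

Lemma tail_coord_ge0 n (w : simplex n.+1) i : 0 <= tail_coord w i.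
Proof.
rewrite addr_ge0//; first by rewrite divr_ge0 ?simplex_ge0// ltW// tail_scale_gt0.
case: ifP => // _; rewrite subr_ge0 ler_pdivrMr ?tail_scale_gt0// mul1r.
by rewrite le_max lexx.
Qed.

Lemma tail_coord_sum n (w : simplex n.+1) : \sum_i tail_coord w i = 1.
Proof.
rewrite big_split/= -mulr_suml -big_mkcond big_pred1_eq.
have -> : \sum_i val w 0 (lift ord0 i) = 1 - val w 0 ord0.
  by rewrite -(simplex_sum1 w) [in RHS]big_ord_recl addrC addKr.
by rewrite subrKC.
Qed.

Definition tail_pt n (w : simplex n.+1) : simplex n :=
  mk_simplex (tail_coord_ge0 w) (tail_coord_sum w).

Lemma tail_ptE n (w : simplex n.+1) i : val w 0 ord0 <= 2^-1 ->
  val (tail_pt w) 0 i = val w 0 (lift ord0 i) / (1 - val w 0 ord0).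
Proof.
move=> w0; have w1 : 2^-1 <= 1 - val w 0 ord0 by lra.
rewrite mk_simplexE /tail_coord /tail_scale max_l// divff; last by lra.
by rewrite subrr if_same addr0.
Qed.

Lemma tail_pt_continuous n : continuous (@tail_pt n).
Proof.
apply: simplex_continuous => i.
have cscale : continuous (fun w : simplex n.+1 => (tail_scale w)^-1).
  apply: continuousV_fun => [|w]; last by rewrite gt_eqF// tail_scale_gt0.
  apply: max_fun_continuous; last exact: cst_continuous.
  by apply: continuousB_fun; [exact: cst_continuous | exact: simplex_coord_continuous].
rewrite (_ : (fun _ => _) = fun w : simplex n.+1 => tail_coord w i); last first.
  by apply/funext => w; rewrite mk_simplexE.
apply: continuousD_fun.
  by apply: continuousM_fun => //; exact: simplex_coord_continuous.
case: (i == ord0); last exact: cst_continuous.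
apply: continuousB_fun; first exact: cst_continuous.
apply: continuousM_fun => //.
by apply: continuousB_fun; [exact: cst_continuous | exact: simplex_coord_continuous].
Qed.

Lemma tail_pt_cone m n (a : mono m n) (w : simplex m.+1) :
  val w 0 ord0 <= 2^-1 -> tail_pt (push (cone a) w) = push a (tail_pt w).
Proof.
move=> w0; apply: simplex_ext => j.
rewrite tail_ptE push_cone0// push_coneS pushE mulr_suml.
by apply: eq_bigr => i _; rewrite tail_ptE.
Qed.

Lemma push_base0 n (t : simplex n) : val (push (base n) t) 0 ord0 = 0.
Proof. by rewrite -cone_pt_base cone_pt0 clamp_le0. Qed.

Lemma tail_pt_base n (t : simplex n) : tail_pt (push (base n) t) = t.
Proof.
have p0 := push_base0 t.
apply: simplex_ext => i; rewrite tail_ptE p0 ?invr_ge0 ?ler0n//.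
by rewrite subr0 divr1 -cone_pt_base cone_ptS clamp_le0// subr0 mul1r.
Qed.

End Faces.

Section Telescope.
Context {R : realType} {S : convenient_category} {D : category}.
Variables (T : diagram R S D) (J : small) (M : J -> small).

Definition elements : Type := {d & T d}.
Definition element d (x : T d) : elements := existT (fun d => T d : Type) d x.

(** Smallness relative to the family [M]. Functions are partial, so that subsets
    of small sets are small. *)
Definition covered (U : set elements) : Prop :=
  exists j (r : M j -> option elements), forall x, U x -> exists m, r m = Some x.

Lemma coveredS U V : U `<=` V -> covered V -> covered U.
Proof. by move=> UV [j [r rV]]; exists j, r => x /UV; exact: rV. Qed.

Section Points.
Variable d : D.

(** The points of the diagram at [d] are the pairs of a set [U] of elements and
    an element [x] of [T d] in [U], and a cone point [None]. The order enlarges [U],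
    and the cone point is above exactly the pairs with [U] small.
    As a model of homotopy types, this is the union of [T] and of the cones on
    all its small subdiagrams, where the cones share their apex and are glued by
    homotopies along inclusions. *)
Definition ple (p q : option (set elements * T d)) : Prop :=
  match p, q with
  | None, None => True
  | None, Some _ => False
  | Some p, None => covered p.1
  | Some p, Some q => p.2 = q.2 /\ p.1 `<=` q.1
  end.

Lemma ple_refl p : ple p p. Proof. by case: p => // p; split. Qed.

Lemma ple_trans p q r : ple p q -> ple q r -> ple p r.
Proof.
case: p q r => [[U x]|] [[V y]|] [[W z]|] //=.
  by move=> [-> UV] [-> VW]; split=> //; exact: subset_trans UV VW.
by move=> [_ UV]; exact: coveredS.
Qed.

(** Membership is required of all the images of [x], so that pairs can be
    transported along arrows with [U] unchanged. *)
Definition zvalid (p : set elements * T d) : Prop :=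
  forall b (u : arrow d b), p.1 (element (diag_arrow T u p.2)).

Definition zpoint : Type := option {p : set elements * T d | zvalid p}.

Definition zval (z : zpoint) : option (set elements * T d) := omap sval z.

Lemma zval_inj z z' : zval z = zval z' -> z = z'.
Proof.
case: z z' => [[p pP]|] [[q qP]|] //= [pq]; congr Some; exact: eq_exist.
Qed.

Lemma zvalP z p : zval z = Some p -> zvalid p.
Proof. by case: z => //= -[q qP] [<-]. Qed.

Definition zle (z z' : zpoint) : Prop := ple (zval z) (zval z').

Definition zspace : space R S := alexandrov_space zle R S.

Lemma zcontinuousP (X : topologicalType) (f : X -> zspace) :
  continuous f <->
  forall x, \forall x' \near x, ple (zval (f x)) (zval (f x')).
Proof.
apply: (@alexandrov_continuousP _ zle) => [x|x y z]; first exact: ple_refl.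
exact: ple_trans.
Qed.

(** Cutting [U] down to a small set [V] gives a point below both the
    original one and the cone point; it is how points reach the cone point. *)
Definition zcut (V : set elements) (z : zpoint) :
    (forall p, zval z = Some p -> zvalid (V, p.2)) -> zpoint :=
  match z with
  | Some p => fun H => Some (exist zvalid ((sval p).1 `&` V, (sval p).2)
      (fun b u => conj (svalP p b u) (H _ erefl b u)))
  | None => fun=> None
  end.

Lemma zval_zcut V z H :
  zval (@zcut V z H) = omap (fun p => (p.1 `&` V, p.2)) (zval z).
Proof. by case: z H. Qed.

End Points.

Definition zmap a b (u : arrow a b) (z : zpoint a) : zpoint b :=
  omap (fun p : {p | zvalid p} =>
    exist (@zvalid b) ((sval p).1, diag_arrow T u (sval p).2)
      (fun c v => eq_ind _ (fun y => (sval p).1 (element y))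
        (svalP p c (arrow_comp v u))
        _ (diag_comp v u (sval p).2))) z.

Lemma zval_zmap a b (u : arrow a b) (z : zpoint a) :
  zval (zmap u z) = omap (fun p => (p.1, diag_arrow T u p.2)) (zval z).
Proof. by case: z. Qed.

Lemma zmap_continuous a b (u : arrow a b) :
  continuous (zmap u : zspace a -> zspace b).
Proof.
apply/zcontinuousP => z.
have /zcontinuousP /(_ z) : continuous (id : zspace a -> zspace a).
  by move=> y; exact: cvg_id.
apply: filterS => z'; rewrite !zval_zmap /=.
by case: (zval z) (zval z') => [[U x]|] [[V y]|] //= [] /= -> UV; split.
Qed.

Lemma zmap_id a (z : zspace a) : mkcts (zmap_continuous (u := arrow_id a)) z = z.
Proof.
apply: zval_inj; rewrite zval_zmap.
by case: (zval z) => [[U x]|] //=; rewrite diag_id.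
Qed.

Lemma zmap_comp a b c (v : arrow b c) (u : arrow a b) (z : zspace a) :
  mkcts (zmap_continuous (u := arrow_comp v u)) z =
  mkcts (zmap_continuous (u := v)) (mkcts (zmap_continuous (u := u)) z).
Proof.
apply: zval_inj; rewrite !zval_zmap.
by case: (zval z) => [[U x]|] //=; rewrite diag_comp.
Qed.

Definition zdiagram : diagram R S D :=
  @Diagram R S D zspace (fun a b u => mkcts (@zmap_continuous a b u))
    zmap_id zmap_comp.

End Telescope.

(** * Function complexes out of small diagrams *)
Section Local.
Context {R : realType} {S : convenient_category} {D : category}.
Variables (T : diagram R S D) (J : small) (M : J -> small).
Variable A : diagram R S D.
Hypothesis A_small : forall n, exists (j : J) (e : M j -> simplex R n * {d & A d}),
  forall p, exists m, e m = p.

Local Notation Z := (zdiagram T M).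

(** All elements of [T] shown by [h] over the face that carries [t]. This set is
    small because the simplex and [A] are, it grows near [t], as the carrier
    does, and it is compatible with all simplicial operators; a bound that
    depended on [h] alone would not be. *)
Definition face_values n (h : hom A Z n) (t : simplex R n) : set (elements T) :=
  [set x | exists (t' : simplex R n) d (a : A d) p,
    [/\ in_carrier t t', zval (heval h t' a : zpoint T d) = Some p &
        x = element p.2]].

Lemma face_values_covered n (h : hom A Z n) t : covered M (face_values h t).
Proof.
have [j [e eP]] := A_small n.
pose ev (q : simplex R n * {d & A d}) : option (elements T) :=
  omap (fun p => element p.2) (zval (heval h q.1 (tagged q.2) : zpoint T (tag q.2))).
exists j, (fun m => ev (e m)) => x [t' [d [a [p [_ hp ->]]]]].
have [m em] := eP (t', existT (fun d => A d : Type) d a).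
by exists m; rewrite em /ev /= hp.
Qed.

Lemma face_values_valid n (h : hom A Z n) t d (a : A d) p :
  zval (heval h t a : zpoint T d) = Some p -> zvalid (face_values h t, p.2).
Proof.
move=> hp b u /=; exists t, b, (diag_arrow A u a), (p.1, diag_arrow T u p.2).
by split=> //; rewrite heval_arrow zval_zmap hp.
Qed.

Lemma face_valuesS n (h : hom A Z n) t t' :
  in_carrier t t' -> face_values h t' `<=` face_values h t.
Proof.
move=> tt' x [w [d [a [p [t'w hp ->]]]]]; exists w, d, a, p; split=> // i wi.
exact/tt'/t'w.
Qed.

Lemma face_values_pull m n (b : mono m n) (h : hom A Z n) t :
  face_values (pull b h) t = face_values h (push b t).
Proof.
apply/seteqP; split=> x [t' [d [a [p [tt' hp ->]]]]].
  exists (push b t'), d, a, p; split=> //; first exact: in_carrier_push.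
  by rewrite -heval_pull.
have [t'' tt'' t't] := in_carrier_lift tt'.
by exists t'', d, a, p; split=> //; rewrite heval_pull t't.
Qed.

Section ConeSimplex.
Variables (n : nat) (h : hom A Z n).

(** The cone on [h]: near the base it is [h], near the apex it is the cone point,
    and halfway it is [h] cut down to the small sets [face_values], a map that is
    below both. As open sets are upward closed, a map that jumps up outside a
    closed set is continuous. *)
Definition cone_value d (w : simplex R n.+1) (a : A d) : zpoint T d :=
  if val w 0 ord0 < 2^-1 then heval h (tail_pt w) a
  else if 2^-1 < val w 0 ord0 then None
  else zcut (@face_values_valid n h (tail_pt w) d a).

Lemma cone_value_lt d (w : simplex R n.+1) (a : A d) :
  val w 0 ord0 < 2^-1 -> cone_value w a = heval h (tail_pt w) a.
Proof. by rewrite /cone_value => ->. Qed.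

Lemma cone_value_gt d (w : simplex R n.+1) (a : A d) :
  2^-1 < val w 0 ord0 -> cone_value w a = None.
Proof. by move=> w0; rewrite /cone_value ltNge (ltW w0) w0. Qed.

Lemma cone_value_eq d (w : simplex R n.+1) (a : A d) :
  val w 0 ord0 = 2^-1 -> zval (cone_value w a) =
  omap (fun p => (p.1 `&` face_values h (tail_pt w), p.2))
    (zval (heval h (tail_pt w) a : zpoint T d)).
Proof. by move=> w0; rewrite /cone_value w0 ltxx zval_zcut. Qed.

Lemma cone_value_continuous d :
  continuous (fun q : tensor (std_simplex n.+1) A d =>
    cone_value (bary q.1) q.2 : Z d).
Proof.
pose Q := tensor (std_simplex n.+1) A d.
have cb : continuous (fun q : Q => bary q.1) by exact: tensor_fst_continuous.
have ct : continuous (fun q : Q => tail_pt (bary q.1)).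
  exact: (@continuous_compT _ _ _ (fun q : Q => bary q.1) (@tail_pt R n) cb
    (@tail_pt_continuous R n)).
have c0 : continuous (fun q : Q => val (bary q.1) 0 ord0).
  exact: (@continuous_compT _ _ _ (fun q : Q => bary q.1)
    (fun w : simplex R n.+1 => val w 0 ord0) cb (@simplex_coord_continuous _ _ _)).
have ch : continuous (fun q : Q => heval h (tail_pt (bary q.1)) q.2).
  apply: heval_continuous => //; first exact: spaceP.
  exact: tensor_snd_continuous.
apply/zcontinuousP => q.
have [w0|w0|w0] := ltgtP (val (bary q.1) 0 ord0) 2^-1.
- have near0 : \forall q' \near q, val (bary q'.1) 0 ord0 < 2^-1.
    exact: (c0 q _ (open_nbhs_nbhs (conj (@open_lt _ 2^-1) w0))).
  move/zcontinuousP/(_ q) : ch; apply: filterS2 near0 => q' w0'.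
  by rewrite !cone_value_lt.
- have : \forall q' \near q, 2^-1 < val (bary q'.1) 0 ord0.
    exact: (c0 q _ (open_nbhs_nbhs (conj (@open_gt _ 2^-1) w0))).
  by apply: filterS => q' w0'; rewrite !cone_value_gt.
- have near_car := near_in_carrier q ct.
  move/zcontinuousP/(_ q) : ch; apply: filterS2 near_car => q' car.
  rewrite (cone_value_eq _ w0).
  have [w0'|w0'|w0'] := ltgtP (val (bary q'.1) 0 ord0) 2^-1.
  + rewrite cone_value_lt//.
    case: (zval _) (zval _) => [[U x]|] [[V y]|] //=.
      by move=> [-> UV]; split=> // z [/UV].
    by move=> UV; apply: coveredS UV => z [].
  + rewrite cone_value_gt//=.
    case: (zval (heval h (tail_pt (bary q.1)) q.2 : zpoint T d)) => [[U x]|] //= _.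
    by apply: (coveredS _ (face_values_covered h (tail_pt (bary q.1)))) => z [].
  + rewrite (cone_value_eq _ w0').
    case: (zval _) (zval _) => [[U x]|] [[V y]|] //=.
      move=> [-> UV]; split=> // z [/UV Vz fz]; split=> //.
      exact: face_valuesS car _ fz.
    by move=> UV; apply: coveredS UV => z [].
Qed.

Lemma cone_value_arrow w a b (u : arrow a b) (x : A a) :
  cone_value w (diag_arrow A u x) = diag_arrow Z u (cone_value w x).
Proof.
rewrite /cone_value; case: ifP => _; first by rewrite heval_arrow.
case: ifP => _ //; apply: zval_inj.
rewrite zval_zcut heval_arrow !zval_zmap zval_zcut.
by case: (zval _).
Qed.

Definition cone_hom : hom A Z n.+1 :=
  mk_hom cone_value_continuous cone_value_arrow.

Lemma heval_cone_hom w d (a : A d) : heval cone_hom w a = cone_value w a.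
Proof. exact: heval_mk_hom. Qed.

End ConeSimplex.

Definition apex_fun d (t : simplex R 0) (a : A d) : Z d := None : zpoint T d.

Lemma apex_fun_continuous d :
  continuous (fun q : tensor (std_simplex 0) A d => apex_fun (bary q.1) q.2).
Proof. exact: cst_continuous. Qed.

Definition apex_hom : hom A Z 0 :=
  mk_hom apex_fun_continuous (fun _ _ _ _ _ => erefl).

(** Maps from a small diagram to [Z] do not see that the orbit is too large to
    be coned off. *)
Lemma hom_contractible : @contractible R (realization R (hom A Z)).
Proof.
apply: (@cone_contractible R (hom A Z) cone_hom apex_hom) => [m n b h|n h|n h];
    apply: heval_ext => w d a; rewrite heval_pull.
- rewrite !heval_cone_hom.
  have [w0|w0|w0] := ltgtP (val w 0 ord0) 2^-1.
  + by rewrite !cone_value_lt ?push_cone0// tail_pt_cone ?(ltW w0)// heval_pull.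
  + by rewrite !cone_value_gt ?push_cone0.
  + apply: zval_inj; rewrite !cone_value_eq ?push_cone0//.
    by rewrite tail_pt_cone ?w0// heval_pull face_values_pull.
- rewrite heval_cone_hom cone_value_lt ?push_base0 ?invr_gt0 ?ltr0n//.
  by rewrite tail_pt_base.
- rewrite heval_cone_hom cone_value_gt ?heval_mk_hom// pushE.
  rewrite (big_pred1 ord0) => [|i]; last by rewrite ord1.
  by rewrite simplex0_coord invf_lt1// ltrDl.
Qed.

End Local.

(** * Connected components *)
Section Components.
Context {R : realType}.

Lemma interval_open_cover (E A B : set R) : is_interval E -> open A -> open B ->
  E `<=` A `|` B -> E `&` A `&` B `<=` set0 -> E `&` A !=set0 -> E `<=` A.
Proof.
move=> /connected_intervalP cE oA oB EAB AB0 EA0.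
have EAE : E `&` A = E.
  apply: cE => //; first by exists A.
  exists (~` B); first exact: open_closedC.
  apply/seteqP; split=> s [Es].
    by move=> As; split=> // Bs; exact: (AB0 s).
  by move=> nBs; split=> //; case: (EAB s Es).
by rewrite -EAE => s [].
Qed.

(** This relation is weaker than being joined by a path, but sufficient to
    tell apart the two points of [full_apex_component], and it passes through
    realizations without approximation of paths by chains of simplices. *)
Definition same_component (X : topologicalType) (x y : X) : Prop :=
  forall chi : X -> bool, continuous chi -> chi x = chi y.

Lemma same_component_image (X Y : topologicalType) (f : X -> Y) x y :
  continuous f -> same_component x y -> same_component (f x) (f y).
Proof.
by move=> cf xy chi cchi; apply: (xy (chi \o f)); exact: continuous_compT.
Qed.

Lemma same_component_sym (X : topologicalType) (x y : X) :
  same_component x y -> same_component y x.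
Proof. by move=> xy chi cchi; rewrite (xy chi). Qed.

Lemma same_component_trans (X : topologicalType) (y x z : X) :
  same_component x y -> same_component y z -> same_component x z.
Proof. by move=> xy yz chi cchi; rewrite (xy chi)// (yz chi). Qed.

Lemma real_line_component (s s' : R) : same_component s s'.
Proof.
move=> chi cchi.
have ochi b : open [set r | chi r = b].
  apply: (@open_comp _ _ chi [set b]) => [r _|]; first exact: cchi.
  exact: (@discrete_open bool).
have /(_ s' I) : [set: R] `<=` [set r | chi r = chi s].
  apply: (interval_open_cover (B := [set r | chi r = ~~ chi s])) => //.
  - move=> r _; have [rs|rs] := pselect (chi r = chi s); [by left|right].
    by move: rs; rewrite /=; case: (chi r) (chi s) => [] [].
  - by move=> r [[_ /= ->]]; case: (chi s).
  - by exists s.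
by [].
Qed.

Definition seg_coord n (t t' : simplex R n) (s : R) (i : 'I_n.+1) : R :=
  (1 - clamp s) * val t 0 i + clamp s * val t' 0 i.

Lemma seg_coord_ge0 n (t t' : simplex R n) s i : 0 <= seg_coord t t' s i.
Proof.
by rewrite addr_ge0// mulr_ge0 ?simplex_ge0 ?clamp_ge0// subr_ge0 clamp_le1.
Qed.

Lemma seg_coord_sum n (t t' : simplex R n) s : \sum_i seg_coord t t' s i = 1.
Proof. by rewrite big_split/= -!mulr_sumr !simplex_sum1 !mulr1 subrK. Qed.

Definition seg n (t t' : simplex R n) (s : R) : simplex R n :=
  mk_simplex (seg_coord_ge0 t t' s) (seg_coord_sum t t' s).

Lemma seg0 n (t t' : simplex R n) : seg t t' 0 = t.
Proof.
apply: simplex_ext => i.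
by rewrite mk_simplexE /seg_coord clamp_le0// subr0 mul1r mul0r addr0.
Qed.

Lemma seg1 n (t t' : simplex R n) : seg t t' 1 = t'.
Proof.
apply: simplex_ext => i.
by rewrite mk_simplexE /seg_coord clamp_ge1// subrr mul1r mul0r add0r.
Qed.

Lemma seg_continuous n (t t' : simplex R n) : continuous (seg t t').
Proof.
apply: simplex_continuous => i.
rewrite (_ : (fun _ => _) = (seg_coord t t')^~ i); last first.
  by apply/funext => s; rewrite mk_simplexE.
apply: continuousD_fun; apply: continuousM_fun; try exact: cst_continuous.
  by apply: continuousB_fun; [exact: cst_continuous | exact: clamp_continuous].
exact: clamp_continuous.
Qed.

Lemma simplex_component n (t t' : simplex R n) : same_component t t'.
Proof.
rewrite -(seg0 t t') -{2}(seg1 t t'); apply: same_component_image.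
  exact: seg_continuous.
exact: real_line_component.
Qed.

Definition cube0 : cube R 0.
Proof. by exists 0; apply: mem_set => -[]. Defined.

Lemma based0 (X : topologicalType) (x : X) (g : continuousType (cube R 0) X) :
  based x g.
Proof. by move=> t [[]]. Qed.

(** The relation of being homotopic as maps from the 0-cube, which is what weak
    homotopy equivalences reflect. *)
Definition path_joined (X : topologicalType) (x y : X) : Prop :=
  exists H : continuousType (unit_interval R * cube R 0)%type X,
    (forall s t, val s = 0 -> H (s, t) = x) /\
    (forall s t, val s = 1 -> H (s, t) = y).

Lemma path_joined_refl (X : topologicalType) (x : X) : path_joined x x.
Proof. by exists (cst x). Qed.

Lemma path_joined_component (X : topologicalType) (x y : X) :
  path_joined x y -> same_component x y.
Proof.
move=> [H [H0 H1]].
have <- : H (to_unit 0, cube0) = x by apply: H0; exact: clamp_le0.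
have <- : H (to_unit 1, cube0) = y by apply: H1; exact: clamp_ge1.
apply: (same_component_image (f := fun s => H (to_unit s, cube0))).
  apply: (@continuous_compT _ _ _ (fun s => (to_unit s, cube0)) H);
    last exact: cts_fun.
  by apply: continuous_pair; [exact: to_unit_continuous | exact: cst_continuous].
exact: real_line_component.
Qed.

Lemma cube0_all (t : cube R 0) : t = cube0.
Proof. by apply: val_inj; apply/rowP => -[]. Qed.

Section WeakEquivalence.
Variables (X Y : topologicalType) (f : continuousType X Y).
Hypothesis wf : weak_homotopy_equivalence R f.

Lemma weak_equivalence_surj (y : Y) : exists x, path_joined (f x) y.
Proof.
have [x0] := wf.1 (inhabits y); have [_ surj] := wf.2 0 x0.
have [g _ [H [H0 H1 _]]] := surj (cst y) (based0 _ _).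
exists (g cube0), H; split=> s t st; last by rewrite H1.
by rewrite H0//= (cube0_all t).
Qed.

Lemma weak_equivalence_inj x x' : path_joined (f x) (f x') -> path_joined x x'.
Proof.
move=> [H [H0 H1]]; have [inj _] := wf.2 0 x.
have := inj (cst x) (cst x') (based0 _ _) (based0 _ _).
case; last by move=> G [G0 G1 _]; exists G; split.
by exists H; split=> // s t [[]].
Qed.

End WeakEquivalence.

End Components.

Section Vertices.
Context {R : realType} {S : convenient_category} {D : category}.
Implicit Types X Y : diagram R S D.

Section OfMap.
Variables (X Y : diagram R S D) (g : dmap X Y).

Lemma vertex_fun_continuous d :
  continuous (fun q : tensor (std_simplex 0) X d => g d q.2).
Proof.
apply: (@continuous_compT _ _ _ (fun q : tensor (std_simplex 0) X d => q.2) (g d)).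
  exact: tensor_snd_continuous.
exact: cts_fun.
Qed.

(** Maps of diagrams are the vertices of the function complex; [map_of_vertex] is
    the converse. *)
Definition vertex_hom : hom X Y 0 :=
  mk_hom (w := fun d _ x => g d x) vertex_fun_continuous
    (fun _ a b u x => dmap_nat g u x).

Definition vertex : realization R (hom X Y) := rpoint vertex_hom simplex0.

Lemma heval_vertex_hom t d (x : X d) : heval vertex_hom t x = g d x.
Proof. exact: heval_mk_hom. Qed.

End OfMap.

Section ToMap.
Variables (X Y : diagram R S D) (h : hom X Y 0).

Lemma map_of_vertex_continuous d :
  continuous (fun x : X d => heval h simplex0 x).
Proof.
apply: heval_continuous; first exact: spaceP.
  exact: cst_continuous.
by move=> x; exact: cvg_id.
Qed.

Definition map_of_vertex : dmap X Y :=
  @DMap R S D X Y (fun d => mkcts (@map_of_vertex_continuous d))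
    (fun a b u x => heval_arrow h simplex0 u x).

Lemma map_of_vertexK : vertex_hom map_of_vertex = h.
Proof.
apply: heval_ext => t d x; rewrite heval_vertex_hom (simplex0_eq t simplex0).
by [].
Qed.

End ToMap.

Lemma vertex_dense X Y (p : realization R (hom X Y)) :
  exists g : dmap X Y, same_component p (vertex g).
Proof.
have [n [h [t ->]]] := rpoint_surj p.
exists (map_of_vertex (pull (apex n) h)).
rewrite /vertex map_of_vertexK rpoint_pull.
apply: same_component_image; first exact: rpoint_continuous.
exact: simplex_component.
Qed.

Lemma hom_post_vertex X Y Y' (f : dmap Y Y') (g : dmap X Y) :
  realization_map R (hom_post X f) (vertex g) = vertex (dmap_comp f g).
Proof.
rewrite realization_map_rpoint /vertex; congr rpoint.
apply: heval_ext => t d x; rewrite heval_vertex_hom /=.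
by rewrite -[LHS]/(f d (heval (vertex_hom g) t x)) heval_vertex_hom.
Qed.

Lemma hom_pre_vertex X X' Y (f : dmap X X') (g : dmap X' Y) :
  realization_map R (hom_pre Y f) (vertex g) = vertex (dmap_comp g f).
Proof.
rewrite realization_map_rpoint /vertex; congr rpoint.
apply: heval_ext => t d x; rewrite heval_vertex_hom /=.
rewrite -(@heval_vertex_hom X' Y g t d (f d x)) /heval /=.
congr (vertex_hom g d (_, _)).
Qed.

(** The function complex to the point diagram has one simplex in each dimension,
    so its realization is a point. *)
Lemma hom_post_to_point_constant X Y
    (p q : realization R (hom X Y)) :
  realization_map R (hom_post X (to_point Y)) p =
  realization_map R (hom_post X (to_point Y)) q.
Proof.
have [n [h [t ->]]] := rpoint_surj p; have [m [k [s ->]]] := rpoint_surj q.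
rewrite !realization_map_rpoint.
have pE l (x : hom X (point_diagram R S D) l) (w : simplex R l) :
    rpoint x w = vertex (to_point X).
  have -> : x = pull (@Mono l 0 (fun=> ord0) (fun _ _ _ => leqnn _))
      (vertex_hom (to_point X)).
    by apply: heval_ext => u d y; case: (heval _ _ _); case: (heval _ _ _).
  by rewrite rpoint_pull /vertex; congr rpoint; exact: simplex0_eq.
by rewrite !pE.
Qed.

End Vertices.

(** * The orbit detects that the diagram is not contractible *)
Section Invariant.
Context {R : realType} {S : convenient_category} {D : category}.
Variables (T : diagram R S D) (J : small) (M : J -> small).
Hypothesis T_orbit : is_orbit T.
Hypothesis T_large : ~ covered M [set: elements T].

Local Notation Z := (zdiagram T M).
Local Notation O := (discretize T).

Definition full d (x : T d) : set (elements T) * T d := (setT, x).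

(** Not even the cone point is above a full point, since the elements of [T] are
    too many. *)
Lemma full_maximal d (x : T d) (q : option (set (elements T) * T d)) :
  ple M (Some (full x)) q -> q = Some (full x).
Proof.
case: q => [[U y]|] /=; last by move/T_large.
move=> [<- UT]; congr (Some (_, _)); apply/seteqP; split=> //.
Qed.

Section Hom.
Variables (n : nat) (h : hom O Z n).

Definition zheval t d (x : T d) : option (set (elements T) * T d) :=
  zval (heval h t (x : O d) : zpoint T d).

(** The first components form a cocone under the orbit, hence are all equal. *)
Lemma zheval_label t : exists l : option (set (elements T)),
  forall d (x : T d), omap fst (zheval t x) = l.
Proof.
pose P := alexandrov_space (@eq (option (set (elements T)))) R S.
pose f d (x : O d) : P := omap fst (zheval t (x : T d)).
have cf d : continuous (f d) by exact: discrete_continuous.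
have natf a b (u : arrow a b) (x : O a) :
    mkcts (cf b) (diag_arrow O u x) = mkcts (cf a) x.
  rewrite /= /mkcts /f /zheval heval_arrow zval_zmap.
  by case: (zval _).
pose g : dmap O (const_diagram D P) := @DMap R S D O (const_diagram D P)
  (fun d => mkcts (cf d)) natf.
have [l gl] := orbit_cocone_constant g (discretize_orbit T_orbit).
by exists l => d x; rewrite -(gl d x).
Qed.

Section Path.
Variables (t t' : simplex R n).

Let point (d : D) (x : T d) (s : R) : Z d := heval h (seg t t' (clamp s)) (x : O d).

Let point_near d (x : T d) (s : R) :
  \forall s' \near s, ple M (zval (point x s)) (zval (point x s')).
Proof.
have : continuous (point x : R -> zspace T M d).
  apply: (@continuous_compT _ _ _ to_unit
    (fun s : unit_interval R => heval h (seg t t' (val s)) (x : O d))).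
    exact: to_unit_continuous.
  apply: heval_continuous; first exact: unit_interval_generated.
    apply: (@continuous_compT _ _ _ (fun s : unit_interval R => val s)).
      exact: val_continuous.
    exact: seg_continuous.
  exact: cst_continuous.
by move/zcontinuousP; exact.
Qed.

Let full_set : set R :=
  [set s | forall d (x : T d), zval (point x s) = Some (full x)].

(** Near a parameter of [full_set] one element stays at a full point, hence by
    [zheval_label] all do. The second components could still vary, as
    endomorphisms of [T]; but each of them is locally constant, hence constant
    on a ball. The ball does not depend on the element. *)
Let full_set_open : open full_set.
Proof.
rewrite openE => s0 s0F.
have [d0 [x0]] := orbit_nonempty T_orbit.
have := point_near x0 s0; rewrite s0F => /nbhs_ballP[e /= e0 eF].
apply/nbhs_ballP; exists e => //= s1 s1e d x.
pose A := [set s | ple M (Some (full x)) (zval (point x s))].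
pose B := [set s | exists2 y, y <> x & ple M (Some (full y)) (zval (point x s))].
suff /(_ s1 s1e) : ball s0 e `<=` A by move/full_maximal.
apply: (@interval_open_cover _ _ A B).
- by rewrite ball_itv; exact: interval_is_interval.
- rewrite openE => s sA; have := point_near x s; apply: filterS => s' ss'.
  exact: ple_trans sA ss'.
- rewrite openE => s [y yx sB]; have := point_near x s; apply: filterS => s' ss'.
  by exists y => //; exact: ple_trans sB ss'.
- move=> s /eF /full_maximal x0s.
  have [l ll] := zheval_label (seg t t' (clamp s)).
  have := ll d x; rewrite -(ll d0 x0) /zheval.
  rewrite -[zval (heval h _ (x0 : O d0))]/(zval (point x0 s)) x0s.
  rewrite -[zval (heval h _ (x : O d))]/(zval (point x s)).
  case sE : (zval (point x s)) => [[U y]|] //= [UE].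
  have [yx|yx] := pselect (y = x); [left|right].
    by rewrite /A /= sE; split; rewrite ?yx ?UE.
  by exists y => //; rewrite sE; split=> //=; rewrite UE.
- by move=> s [[_ /full_maximal sx] [y yx /full_maximal]]; rewrite sx => -[/esym].
- exists s0; split; first exact: ballxx.
  by rewrite /A /= s0F; split.
Qed.

(** At a limit, each element [x] is sent below [full x], so to a pair [(U, x)] with
    the same [U] for all [x]. Then [U] contains every element. *)
Let full_set_closed : closed full_set.
Proof.
move=> s0 s0F d x.
have half b (y : T b) : exists U, zval (point y s0) = Some (U, y).
  have [s [sF]] := s0F _ (point_near y s0); rewrite /= sF.
  by case: (zval _) => [[U z]|] //= [-> _]; exists U.
have [U sU] := half d x; rewrite sU; congr (Some (_, _)).
apply/seteqP; split=> // -[b y] _.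
have [V sV] := half b y.
have [l ll] := zheval_label (seg t t' (clamp s0)).
have := ll d x; rewrite -(ll b y) /zheval.
rewrite -[zval (heval h _ (y : O b))]/(zval (point y s0)) sV.
rewrite -[zval (heval h _ (x : O d))]/(zval (point x s0)) sU /= => -[->].
by have /= := zvalP sV (arrow_id b); rewrite diag_id.
Qed.

(** The inclusion of the orbit as full points admits no deformation inside the
    maps from the orbit to [Z]. *)
Lemma full_path : (forall d (x : T d), zheval t x = Some (full x)) ->
  forall d (x : T d), zheval t' x = Some (full x).
Proof.
move=> tF.
have : [set: R] `<=` full_set.
  apply: (@interval_open_cover _ _ _ (~` full_set)) => //.
  - exact: closed_openC.
  - by move=> s _; exact: EM.
  - by move=> s [[_ sF]]; exact.
  - exists 0; split=> // d x; rewrite /point clamp_le0// seg0; exact: tF.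
move=> /(_ 1 I) F1 d x; have := F1 d x.
by rewrite /point clamp_ge1// seg1.
Qed.

End Path.
End Hom.

Definition is_full n (h : hom O Z n) (t : simplex R n) : bool :=
  `[< forall d (x : T d), zheval h t x = Some (full x) >].

Lemma is_full_pull m n (a : mono m n) (h : hom O Z n) (t : simplex R m) :
  is_full (pull a h) t = is_full h (push a t).
Proof.
apply: asbool_equiv_eq; split=> hF d x; have := hF d x;
  by rewrite /zheval heval_pull.
Qed.

Definition is_full_component : realization R (hom O Z) -> bool :=
  realization_lift is_full.

Lemma is_full_component_continuous : continuous is_full_component.
Proof.
apply: realization_lift_continuous; first exact: is_full_pull.
move=> n h; pose t0 : simplex R n := push (apex n) simplex0.
rewrite (_ : is_full h = cst (is_full h t0)); first exact: cst_continuous.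
by apply/funext => t; apply: asbool_equiv_eq; split; exact: full_path.
Qed.

Definition full_map_point d (x : T d) : zpoint T d :=
  Some (exist (@zvalid _ _ _ T d) (full x) (fun b u => I)).

Lemma full_map_nat a b (u : arrow a b) (x : O a) :
  full_map_point (diag_arrow O u x : T b) = zmap u (full_map_point (x : T a)).
Proof. exact: zval_inj. Qed.

Definition full_map : dmap O Z :=
  @DMap R S D O Z (fun d => mkcts (@discrete_continuous (T d) (Z d)
    (@full_map_point d))) full_map_nat.

Definition apex_map : dmap O Z :=
  @DMap R S D O Z (fun d => cst (None : zpoint T d)) (fun _ _ _ _ => erefl).

Lemma full_apex_component : ~ same_component (vertex full_map) (vertex apex_map).
Proof.
move=> /(_ _ is_full_component_continuous).
rewrite /is_full_component /vertex !realization_liftE; try exact: is_full_pull.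
rewrite (_ : is_full _ _ = true); last first.
  by apply/asboolP => d x; rewrite /zheval heval_vertex_hom.
move=> /esym/asboolP aF; have [d [x]] := orbit_nonempty T_orbit.
by have := aF d x; rewrite /zheval heval_vertex_hom.
Qed.

End Invariant.

(** * Size, and the theorem *)
Section Coding.
Context {R : realType} {S : convenient_category} {D : category}.
Implicit Types T : diagram R S D.

Lemma element_inj T d : injective (@element R S D T d).
Proof.
move=> x y e; have := projT2_eq e.
by rewrite (Prop_irrelevance (projT1_eq e) erefl).
Qed.

Section Code.
Variables (K : small) (T : diagram R S D) (r : K -> option (elements T)).

(** A surjection from a subset of [K] to the elements of [T] transports the
    structure of [T] to [K]. The open sets and the graphs of the arrows, read on
    [K], determine [T] up to isomorphism, and there is only a set of such codes.
    The graphs of identity arrows also record which points of [K] name the same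
    element, and in which space it lies. *)
Definition code_type : Type :=
  ((set K -> D -> Prop) * (forall a b : D, arrow a b -> K -> K -> Prop))%type.

Definition code : code_type :=
  (fun P d => open [set x : T d | exists2 m, P m & r m = Some (element x)],
   fun a b u m m' => exists2 x : T a,
     r m = Some (element x) & r m' = Some (element (diag_arrow T u x))).

End Code.

Lemma code_map (K : small) T T' (r : K -> option (elements T))
    (r' : K -> option (elements T')) :
  (forall x, exists m, r m = Some x) -> (forall x, exists m, r' m = Some x) ->
  code r = code r' ->
  exists f : dmap T T', forall d (x : T d) m,
    r m = Some (element x) -> r' m = Some (element (f d x)).
Proof.
move=> rP r'P rr'.
have arr a b (u : arrow a b) m m' (x : T a) : r m = Some (element x) ->
    r m' = Some (element (diag_arrow T u x)) -> exists2 y : T' a,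
    r' m = Some (element y) & r' m' = Some (element (diag_arrow T' u y)).
  move=> mx m'x; have : (code r).2 a b u m m' by exists x.
  by rewrite rr'.
have ptP d (x : T d) : exists y : T' d, forall m,
    r m = Some (element x) -> r' m = Some (element y).
  have [m0 m0x] := rP (element x).
  have idx : diag_arrow T (arrow_id d) x = x := diag_id x.
  have [|y m0y _] := @arr d d (arrow_id d) m0 m0 x m0x; first by rewrite idx.
  exists y => m mx; have [|y' m0y' my'] := @arr d d (arrow_id d) m0 m x m0x.
    by rewrite idx.
  rewrite my' diag_id; congr (Some _); rewrite m0y in m0y'.
  by case: m0y' => /element_inj ->.
pose f d (x : T d) : T' d := projT1 (cid (ptP d x)).
have fP d (x : T d) m : r m = Some (element x) -> r' m = Some (element (f d x)).
  by rewrite /f; case: cid => y /= h /h.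
have cf d : continuous (f d).
  apply/continuousP => V oV.
  pose P m := exists2 y : T' d, V y & r' m = Some (element y).
  have : (code r').1 P d.
    rewrite /code /= (_ : [set _ | _] = V)//; apply/seteqP; split=> y.
      by move=> [m [y' Vy' my']]; rewrite my' => -[/element_inj <-].
    by move=> Vy; have [m my] := r'P (element y); exists m => //; exists y.
  rewrite -rr' /code /= (_ : [set _ | _] = f d @^-1` V)//.
  apply/seteqP; split=> x.
    move=> [m [y Vy my] /fP]; rewrite my => -[/element_inj yE].
    by rewrite /= -yE.
  move=> Vfx; have [m mx] := rP (element x); exists m => //.
  by exists (f d x) => //; exact: fP.
have natf a b (u : arrow a b) (x : T a) :
    mkcts (cf b) (diag_arrow T u x) = diag_arrow T' u (mkcts (cf a) x).
  have [m mx] := rP (element x); have [m' m'x] := rP (element (diag_arrow T u x)).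
  have [y my m'y] := arr _ _ _ _ _ _ mx m'x.
  have := fP _ _ _ mx; rewrite my => -[/element_inj yE].
  have := fP _ _ _ m'x; rewrite m'y => -[/element_inj uyE].
  by rewrite /mkcts /= -uyE yE.
by exists (@DMap R S D T T' (fun d => mkcts (cf d)) natf) => d x m; exact: fP.
Qed.

Lemma code_isomorphic (K : small) T T' (r : K -> option (elements T))
    (r' : K -> option (elements T')) :
  (forall x, exists m, r m = Some x) -> (forall x, exists m, r' m = Some x) ->
  code r = code r' -> isomorphic T T'.
Proof.
move=> rP r'P rr'; have [f fP] := code_map rP r'P rr'.
have [g gP] := code_map r'P rP (esym rr').
exists f, g; split; apply: dmap_ext => d x.
  have [m mx] := rP (element x); have := gP _ _ _ (fP _ _ _ mx).
  by rewrite mx => -[/element_inj].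
have [m mx] := r'P (element x); have := fP _ _ _ (gP _ _ _ mx).
by rewrite mx => -[/element_inj].
Qed.

(** Otherwise each member of the class would be determined by a code on one of
    the [M j], so that the class would be indexed by a set. *)
Lemma proper_class_large (C : diagram R S D -> Prop) (J : small) (M : J -> small) :
  pairwise_non_isomorphic C -> proper_class C ->
  exists2 T, C T & ~ covered M [set: elements T].
Proof.
move=> Cniso Cproper; apply: contrapT => large; apply: Cproper.
have Ccov T : C T -> covered M [set: elements T].
  by move=> CT; apply: contrapT => ncov; apply: large; exists T.
pose coded (i : {j & code_type (M j)}) T := C T /\
  exists r : M (tag i) -> option (elements T),
    (forall x, exists m, r m = Some x) /\ tagged i = code r.
pose decode i := if pselect (exists T, coded i T) is left h
  then projT1 (cid h) else point_diagram R S D.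
exists {j & code_type (M j)}, decode => T CT.
have [j [r rP]] := Ccov T CT.
exists (Tagged (fun j => code_type (M j)) (code r)).
have cT : coded (Tagged (fun j => code_type (M j)) (code r)) T.
  by split=> //; exists r; split=> // x; exact: rP.
rewrite /decode; case: pselect => [h|[]]; last by exists T.
case: cid => T' [CT' [r' [r'P rr']]] /=.
by apply: Cniso => //; apply: (code_isomorphic _ _ rr') => // x; exact: rP.
Qed.

End Coding.

Theorem theorem2p4 (R : realType) (S : convenient_category) (D : category)
    (hD : exists C : diagram R S D -> Prop,
      [/\ forall T : diagram R S D, C T -> is_orbit T /\ is_regular T,
          pairwise_non_isomorphic C &
          proper_class C]) :
  ~ exists (F : map_set R S D) (L : coaugmented_functor R S D),
      is_localization F L /\
      forall X : diagram R S D, weak_equivalence (to_point (L X)).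
Proof.
case: hD => C [Corb Cniso Cproper] [F [L [locL trivL]]].
have approx (i : map_index F) : exists A B (f : dmap A B),
    cofibrant_approximation (map_of i) f.
  have [[_ /(_ i)[A [B [f [fi _]]]]] _] := locL (point_diagram R S D).
  by exists A, B, f.
(* The sources and targets of cofibrant approximations of the maps of [F].
   Their points, with parameters in simplices, measure smallness. *)
pose X (i : map_index F) (b : bool) :=
  if b then projT1 (cid (approx i)) else projT1 (cid (projT2 (cid (approx i)))).
pose f i : dmap (X i true) (X i false) :=
  projT1 (cid (projT2 (cid (projT2 (cid (approx i)))))).
have fP i : cofibrant_approximation (map_of i) (f i) :=
  projT2 (cid (projT2 (cid (projT2 (cid (approx i)))))).
pose M (j : map_index F * bool * nat) : Type :=
  (simplex R j.2 * {d & X j.1.1 j.1.2 d})%type.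
have [T CT T_large] := proper_class_large M Cniso Cproper.
have [T_orbit _] := Corb T CT.
pose Z := zdiagram T M; pose O := discretize T.
have O_orbit : is_orbit O := discretize_orbit T_orbit.
have X_small i b : contractible (R := R) (realization R (hom (X i b) Z)).
  apply: hom_contractible => n; exists (i, b, n), id => p; by exists p.
have Z_local : is_local F Z.
  split=> [|i]; first exact: every_diagram_fibrant.
  exists (X i true), (X i false), (f i); split; first exact: fP.
  exact: contractible_weak_equivalence.
(* Up to homotopy, the map [a] to [Z] factors through [B], which is equivalent
   to a contractible diagram; so all maps from [O] to [Z] are in one component. *)
have [_ [A [B [g [[_ _ [a [b [wa wb _]]]] gP]]]]] := locL Z.
have wg := gP Z Z_local.
have lift (k : dmap O Z) : exists k' : dmap O A,
    same_component (vertex k) (vertex (dmap_comp a k')).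
  have [p /path_joined_component pk] :=
    weak_equivalence_surj (wa O O_orbit) (vertex k).
  have [k' pk'] := vertex_dense p; exists k'; rewrite -hom_post_vertex.
  apply: same_component_trans (same_component_sym pk) _.
  exact: (same_component_image
    (@cts_fun _ _ (realization_map R (hom_post O a))) pk').
have [k kP] : exists k : dmap B Z,
    same_component (vertex a) (vertex (dmap_comp k g)).
  have [p /path_joined_component pa] := weak_equivalence_surj wg (vertex a).
  have [k pk] := vertex_dense p; exists k; rewrite -hom_pre_vertex.
  apply: same_component_trans (same_component_sym pa) _.
  exact: (same_component_image (@cts_fun _ _ (realization_map R (hom_pre Z g))) pk).
have all_joined (u v : dmap O B) : same_component (vertex u) (vertex v).
  apply: path_joined_component; apply: (weak_equivalence_inj (wb O O_orbit)).
  apply: (weak_equivalence_inj (trivL Z O O_orbit)).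
  rewrite (hom_post_to_point_constant _
    (realization_map R (hom_post O b) (vertex v))).
  exact: path_joined_refl.
have push_lift (u : dmap O A) :
    same_component (vertex (dmap_comp a u)) (vertex (dmap_comp k (dmap_comp g u))).
  have -> : dmap_comp k (dmap_comp g u) = dmap_comp (dmap_comp k g) u.
    exact: dmap_ext.
  rewrite -(hom_pre_vertex u a) -(hom_pre_vertex u (dmap_comp k g)).
  exact: (same_component_image (@cts_fun _ _ (realization_map R (hom_pre Z u))) kP).
apply: (full_apex_component T_orbit T_large).
have [u uP] := lift (full_map T M); have [v vP] := lift (apex_map T M).
apply: same_component_trans uP _; apply: same_component_trans (push_lift u) _.
apply: same_component_trans (same_component_sym (same_component_trans vP (push_lift v))).
rewrite -(hom_post_vertex k (dmap_comp g u)) -(hom_post_vertex k (dmap_comp g v)).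
exact: (same_component_image (@cts_fun _ _ (realization_map R (hom_post O k)))
  (all_joined _ _)).
Qed.
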